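(* Let $\Gamma\subset\mathrm{SL}(n,\mathbb{R})$ be a projective Anosov subgroup, with limit set $\Lambda_\Gamma=\xi(\partial_\infty\Gamma)\subset\mathbf{P}(\mathbb{R}^n)$. Then $\dim_H(\Lambda_\Gamma)\le\delta_{1,2}(\Gamma)$.
   Context: For $g\in\mathrm{SL}(n,\mathbb{R})$, $\mu_i(g)$ is the logarithm of the $i$-th eigenvalue (decreasing order) of $\sqrt{gg^T}$. A finitely generated $\Gamma\subset\mathrm{SL}(n,\mathbb{R})$ is projective Anosov if there are $C,C'>0$ with $\mu_1(g)-\mu_2(g)\ge C|g|-C'$ for all $g\in\Gamma$ ($|g|$ word length). Such $\Gamma$ is Gromov hyperbolic and has a continuous $\Gamma$-equivariant boundary map $\xi:\partial_\infty\Gamma\to\mathbf{P}(\mathbb{R}^n)$ such that, for every infinite-order $g\in\Gamma$, $\xi(g_+)$ is the eigenline of the unique eigenvalue of $g$ of maximal modulus ($g_+$ the attracting fixed point of $g$ in $\partial_\infty\Gamma$). $\delta_{1,2}(\Gamma)=\limsup_{R\to\infty}\frac1R\log\#\{\gamma\in\Gamma:\mu_1(\gamma)-\mu_2(\gamma)\le R\}$. $\dim_H$ is the Hausdorff dimension for any Riemannian metric on $\mathbf{P}(\mathbb{R}^n)$. *)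

(* Defs.v *)
From HB Require Import structures.
From mathcomp Require Import all_boot all_order all_algebra.
From mathcomp Require Import all_classical all_reals all_analysis.
From mathcomp Require Import complex.
Set Implicit Arguments. Unset Strict Implicit. Unset Printing Implicit Defensive.
Import Order.TTheory GRing.Theory Num.Theory.
Import numFieldNormedType.Exports.
Local Open Scope classical_set_scope.
Local Open Scope ring_scope.

Section ProjAnosov.
Variables (R : realType) (n : nat).
Local Notation Mat := 'M[R]_n.
Local Notation Vec := 'cV[R]_n.

Definition is_word (S : seq Mat) (w : seq Mat) : bool :=
  all (fun a => a \in S ++ map invmx S) w.

Definition word_eval (w : seq Mat) : Mat := foldr mulmx 1%:M w.

Definition in_gen (S : seq Mat) (g : Mat) : Prop :=
  exists w, is_word S w /\ word_eval w = g.

Definition wlen (S : seq Mat) (g : Mat) : R :=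
  inf [set (size w)%:R | w in [set w | is_word S w /\ word_eval w = g]].

Definition sq_sv_list (g : Mat) (s : seq R) : Prop :=
  size s = n /\ sorted (fun x y => y <= x) s /\
  char_poly (g *m g^T) = \prod_(x <- s) ('X - x%:P).

(* mu_i(g) = log of the i-th eigenvalue of sqrt(g g^T) = (1/2) log of the
   i-th eigenvalue of g g^T *)
Definition mu (g : Mat) (i : nat) : R :=
  ln (nth 0 (xget [::] (sq_sv_list g)) i) / 2.

Definition gap12 (g : Mat) : R := mu g 0 - mu g 1.

Definition proj_anosov (S : seq Mat) : Prop :=
  exists C C' : R, 0 < C /\ 0 < C' /\
    forall g, in_gen S g -> C * wlen S g - C' <= gap12 g.

Definition delta12 (S : seq Mat) : \bar R :=
  let f := fun T : R =>
    (lne (counting [set g | in_gen S g /\ (gap12 g <= T)%R]) * (T^-1)%:E)%E in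
  (* limf_esup f (pinfty_nbhs R), unfolded *)
  ereal_inf [set ereal_sup (f @` V) | V in pinfty_nbhs R].

Definition gprod (S : seq Mat) (g h : Mat) : R :=
  (wlen S g + wlen S h - wlen S (invmx g *m h)) / 2.

Definition conv_inf (S : seq Mat) (x : nat -> Mat) : Prop :=
  (forall k, in_gen S (x k)) /\
  forall M : R, exists N, forall i j, (N <= i)%N -> (N <= j)%N ->
    M <= gprod S (x i) (x j).

(* two such sequences define the same boundary point *)
Definition bequiv (S : seq Mat) (x y : nat -> Mat) : Prop :=
  forall M : R, exists N, forall i j, (N <= i)%N -> (N <= j)%N ->
    M <= gprod S (x i) (y j).

(* the sequence of boundary points [a m] converges to [x] in the boundary *)
Definition bconv (S : seq Mat) (a : nat -> nat -> Mat) (x : nat -> Mat) : Prop :=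
  forall M : R, exists m0, forall m, (m0 <= m)%N ->
    exists N, forall i j, (N <= i)%N -> (N <= j)%N -> M <= gprod S (a m i) (x j).

(** ---------- Projective space: lines represented by nonzero vectors ---------- *)

Definition dotv (u v : Vec) : R := \sum_i u i ord0 * v i ord0.

(* the sine of the angle between the lines [u] and [v]; a metric on P(R^n)
   bi-Lipschitz equivalent to the Fubini--Study Riemannian distance *)
Definition dP (u v : Vec) : R :=
  Num.sqrt (1 - dotv u v ^+ 2 / (dotv u u * dotv v v)).

Definition same_line (u v : Vec) : Prop :=
  u != 0 /\ v != 0 /\ exists c : R, u = c *: v.

Definition diamP (A : set Vec) : \bar R :=
  ereal_sup [set (dP u v)%:E | u in A & v in A].

Definition hterm (s : R) (U : set Vec) : \bar R :=
  if pselect (U = set0) then 0%E else (powR (fine (diamP U)) s)%:E.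

Definition hausdorff_content (s delta : R) (A : set Vec) : \bar R :=
  ereal_inf [set (\sum_(i <oo) hterm s (U i))%E |
     U in [set U : nat -> set Vec |
             A `<=` \bigcup_i U i /\ forall i, (diamP (U i) <= delta%:E)%E]].

Definition hausdorff_measure (s : R) (A : set Vec) : \bar R :=
  ereal_sup [set hausdorff_content s delta A | delta in [set d : R | 0 < d]].

Definition hausdorff_dim (A : set Vec) : \bar R :=
  ereal_inf [set s%:E | s in [set s : R | 0 <= s /\ hausdorff_measure s A = 0%E]].

(* xi : (sequences converging at infinity in Gamma) -> nonzero vectors, read as a
   map from the Gromov boundary to P(R^n): well defined on boundary points,
   Gamma-equivariant, continuous, and sending the attracting point g_+ = [(g^k)_k]
   of an infinite-order g to the eigenline of its eigenvalue of maximal modulus. *)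
Definition boundary_map (S : seq Mat) (xi : (nat -> Mat) -> Vec) : Prop :=
  [/\ (forall x, conv_inf S x -> xi x != 0),
      (forall x y, conv_inf S x -> conv_inf S y -> bequiv S x y ->
          same_line (xi x) (xi y)),
      (forall g x, in_gen S g -> conv_inf S x ->
          same_line (xi (fun k => g *m x k)) (g *m xi x)),
      (forall (a : nat -> nat -> Mat) x, conv_inf S x ->
          (forall m, conv_inf S (a m)) -> bconv S a x ->
          (fun m => dP (xi (a m)) (xi x)) @ \oo --> (0 : R)) &
      (forall g, in_gen S g -> (forall k, (0 < k)%N -> g ^+ k != 1) ->
          exists lam : R,
            g *m xi (fun k => g ^+ k) = lam *: xi (fun k => g ^+ k) /\
            forall z : R[i], root (map_poly (real_complex R) (char_poly g)) z ->
              complex.Re z ^+ 2 + complex.Im z ^+ 2 <= lam ^+ 2)].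

Definition limit_set (S : seq Mat) (xi : (nat -> Mat) -> Vec) : set Vec :=
  [set xi x | x in conv_inf S].

End ProjAnosov.

(* Main.v *)
(** Let [U(g)] be the top left singular direction of [g], [q(g) = exp(-(mu_1 - mu_2)(g))]
and [|g|] the word length, so that [q(g) <= K theta^|g|] with [theta < 1].

Since [d(U(g), U(gh)) <= cond(h) q(g)], the direction [U] moves by a summable amount
along geodesics of the Cayley graph, and [d(U(p), U(q)) = O(theta^(p|q))] for the
Gromov product [(p|q)]. Conversely, if [a^-1 b] is geodesic and [|a|], [|b|] are large,
then [U(a)] and [U(b)] are uniformly separated: along the inverses [g_t] of the prefixes
of [a] the line [g_t U(b)] is exponentially close to [U(g_t)], which forces
[|g_t U(b)|] to be comparable to the norm of [g_t], whereas a vector near [U(a)] is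
contracted. Together these facts give the hyperbolicity of the word metric that is needed.

A long geodesic contains some subword of a given length twice, and the segment between
the two occurrences spells an element [g] of infinite order; translates of the points
[g_+] obtained in this way accumulate at every boundary point. The domination also shows
that [xi(g_+)] is the limit of [U(g^k)], so by continuity and equivariance
[xi(x) = lim U(x_j)] for every boundary point [x].

Finally, on a geodesic towards [x] there are arbitrarily long elements [gamma] after which
the gap grows at least at half the Anosov rate, and then
[d(U(gamma), xi(x)) = O(q(gamma))]. The balls of these radii around the [U(gamma)] with
[mu_1 - mu_2 > J] cover the limit set, and for [s > delta_{1,2}] the sum of the [s]-th
powers of their radii tends to [0] as [J] grows. *)

Require Import Defs.
From HB Require Import structures.
From mathcomp Require Import finmap all_boot all_order all_algebra.
From mathcomp Require Import all_classical all_reals all_analysis.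
From mathcomp Require Import complex.
From mathcomp Require Import ring lra zify.
Import Order.TTheory GRing.Theory Num.Theory.
Import numFieldNormedType.Exports.
Local Open Scope classical_set_scope.
Local Open Scope ring_scope.

(** * Euclidean geometry of lines and the sine metric *)

Section Euclid.
Context {R : realType} {n : nat}.
Implicit Types (u v w x : 'cV[R]_n) (A : 'M[R]_n) (c : R).

Definition nrm u : R := Num.sqrt (dotv u u).

Lemma dotvC u v : dotv u v = dotv v u.
Proof. by apply: eq_bigr => i _; rewrite mulrC. Qed.

Lemma dotvDl u v w : dotv (u + v) w = dotv u w + dotv v w.
Proof. by rewrite -big_split; apply: eq_bigr => i _; rewrite mxE mulrDl. Qed.

Lemma dotvZl c u v : dotv (c *: u) v = c * dotv u v.
Proof. by rewrite /dotv mulr_sumr; apply: eq_bigr => i _; rewrite mxE mulrA. Qed.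

Lemma dotvNl u v : dotv (- u) v = - dotv u v.
Proof. by rewrite -scaleN1r dotvZl mulN1r. Qed.

Lemma dotvDr u v w : dotv u (v + w) = dotv u v + dotv u w.
Proof. by rewrite dotvC dotvDl !(dotvC u). Qed.

Lemma dotvZr c u v : dotv u (c *: v) = c * dotv u v.
Proof. by rewrite dotvC dotvZl (dotvC u). Qed.

Lemma dotvNr u v : dotv u (- v) = - dotv u v.
Proof. by rewrite dotvC dotvNl (dotvC u). Qed.

Definition dotvE := (dotvDl, dotvDr, dotvNl, dotvNr, dotvZl, dotvZr).

Lemma dotv_ge0 u : 0 <= dotv u u.
Proof. by apply: sumr_ge0 => i _; rewrite -expr2 sqr_ge0. Qed.

Lemma dotv_eq0 u : (dotv u u == 0) = (u == 0).
Proof.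
apply/eqP/eqP => [|->]; last by rewrite /dotv big1 // => i _; rewrite mxE mul0r.
move=> /psumr_eq0P H; apply/matrixP => i j; rewrite ord1 mxE.
by have /eqP := H (fun i _ => sqr_ge0 _) i isT; rewrite mulf_eq0 orbb => /eqP.
Qed.

Lemma dotv_gt0 u : (0 < dotv u u) = (u != 0).
Proof. by rewrite lt0r dotv_eq0 dotv_ge0 andbT. Qed.

Lemma dotv_trmx A x v : dotv (A *m x) v = dotv x (A^T *m v).
Proof.
rewrite /dotv.
under eq_bigr => i _ do rewrite mxE mulr_suml.
rewrite exchange_big; apply: eq_bigr => j _ /=.
by rewrite mxE mulr_sumr; apply: eq_bigr => i _; rewrite mxE; ring.
Qed.

Lemma nrm_ge0 u : 0 <= nrm u. Proof. exact: sqrtr_ge0. Qed.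

Lemma nrm_sq u : nrm u ^+ 2 = dotv u u.
Proof. by rewrite sqr_sqrtr ?dotv_ge0. Qed.

Lemma nrm_gt0 u : (0 < nrm u) = (u != 0).
Proof. by rewrite sqrtr_gt0 dotv_gt0. Qed.

Lemma nrm_eq0 u : (nrm u == 0) = (u == 0).
Proof. by rewrite sqrtr_eq0 -dotv_eq0 eq_le dotv_ge0 andbT. Qed.

Lemma nrm0 : nrm 0 = 0. Proof. by apply/eqP; rewrite nrm_eq0. Qed.

Lemma nrmZ c u : nrm (c *: u) = `|c| * nrm u.
Proof. by rewrite /nrm dotvZl dotvZr mulrA -expr2 sqrtrM ?sqr_ge0// sqrtr_sqr. Qed.

Lemma nrmN u : nrm (- u) = nrm u.
Proof. by rewrite -scaleN1r nrmZ normrN1 mul1r. Qed.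

Lemma nrm_le u c : 0 <= c -> (nrm u <= c) = (dotv u u <= c ^+ 2).
Proof.
by move=> c0; rewrite -nrm_sq ler_pXn2r ?nnegrE ?nrm_ge0.
Qed.

Lemma CauchySchwarz u v : `|dotv u v| <= nrm u * nrm v.
Proof.
have [->|v0] := eqVneq v 0.
  by rewrite nrm0 mulr0 -(scale0r 0) dotvZr mul0r normr0.
rewrite -[leLHS]sqrtr_sqr -sqrtrM ?dotv_ge0// ler_wsqrtr//.
have Dv : 0 < dotv v v by rewrite dotv_gt0.
have := dotv_ge0 (dotv v v *: u - dotv u v *: v).
rewrite !dotvE (dotvC v u) => H.
rewrite -subr_ge0 -(pmulr_rge0 _ Dv).
by apply: le_trans H _; rewrite le_eqVlt; apply/orP; left; apply/eqP; ring.
Qed.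

Lemma nrmD u v : nrm (u + v) <= nrm u + nrm v.
Proof.
rewrite nrm_le ?addr_ge0 ?nrm_ge0// !dotvE (dotvC v u) sqrrD !nrm_sq.
by have := ler_normlW (CauchySchwarz u v); lra.
Qed.

(** The component of [v] orthogonal to the line of [u]. By [nrm_rej] its norm is [nrm v * dP u v],
    which turns projective estimates into linear ones. *)
Definition rej u v := v - (dotv u v / dotv u u) *: u.

Lemma dotv_rej u v : u != 0 -> dotv u (rej u v) = 0.
Proof.
move=> u0; rewrite /rej !dotvE divfK ?subrr//.
by rewrite dotv_eq0.
Qed.

Lemma rejE u v : v = (dotv u v / dotv u u) *: u + rej u v.
Proof. by rewrite addrC subrK. Qed.

Lemma dotv_rej_rej u v : u != 0 ->
  dotv (rej u v) (rej u v) = dotv v v - dotv u v ^+ 2 / dotv u u.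
Proof.
move=> u0; have U : dotv u u != 0 by rewrite dotv_eq0.
by rewrite /rej !dotvE (dotvC v u); field.
Qed.

Lemma nrm_rej u v : u != 0 -> nrm (rej u v) = nrm v * dP u v.
Proof.
move=> u0; have [->|v0] := eqVneq v 0.
  by rewrite /rej -(scale0r 0) dotvZr !mul0r !scale0r subr0 nrm0 mul0r.
rewrite /nrm /dP -sqrtrM ?dotv_ge0// dotv_rej_rej//; congr Num.sqrt.
have U : dotv u u != 0 by rewrite dotv_eq0.
have V : dotv v v != 0 by rewrite dotv_eq0.
by field; rewrite ?U ?V.
Qed.

(** Pythagoras: [v - c *: u] differs from [rej u v] by a multiple of [u]. To bound [dP u v] it is
    thus enough to exhibit some multiple of [u] near [v]. *)
Lemma rej_min u v c : u != 0 -> nrm v * dP u v <= nrm (v - c *: u).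
Proof.
move=> u0; rewrite -nrm_rej// nrm_le ?nrm_ge0// nrm_sq.
have -> : v - c *: u = rej u v + (dotv u v / dotv u u - c) *: u.
  by rewrite scalerBl /rej addrA subrK.
move: (rej u v) (dotv_rej u v u0) (_ - c) => r ur k.
rewrite !dotvE (dotvC r u) ur.
by have := mulr_ge0 (sqr_ge0 k) (dotv_ge0 u); lra.
Qed.

Lemma nrm_rej_le u v : u != 0 -> nrm (rej u v) <= nrm v.
Proof.
move=> u0; have := rej_min u v 0 u0; rewrite scale0r subr0.
by rewrite nrm_rej.
Qed.

Lemma nrm_rej_coef u v : u != 0 -> nrm ((dotv u v / dotv u u) *: u) <= nrm v.
Proof.
move=> u0; rewrite nrm_le ?nrm_ge0// nrm_sq.
rewrite [X in _ <= dotv X X](rejE u v); move: (rej u v) (dotv_rej u v u0) (_ / _).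
move=> r ur k; rewrite !dotvE (dotvC r u) ur.
by have := dotv_ge0 r; lra.
Qed.

Lemma dPC u v : dP u v = dP v u.
Proof. by rewrite /dP dotvC (mulrC (dotv u u)). Qed.

Lemma dP_ge0 u v : 0 <= dP u v. Proof. exact: sqrtr_ge0. Qed.

Lemma dPZl c u v : c != 0 -> dP (c *: u) v = dP u v.
Proof.
move=> c0; have [->|u0] := eqVneq u 0; first by rewrite scaler0.
have [->|v0] := eqVneq v 0.
  by rewrite /dP -(scale0r 0) !dotvZr !mul0r expr2 mulr0 !mul0r.
rewrite /dP !dotvE; congr (Num.sqrt (1 - _)).
have U : dotv u u != 0 by rewrite dotv_eq0.
have V : dotv v v != 0 by rewrite dotv_eq0.
by field; rewrite ?U ?V ?c0.
Qed.

Lemma dPZr c u v : c != 0 -> dP u (c *: v) = dP u v.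
Proof. by move=> c0; rewrite dPC dPZl// dPC. Qed.

Lemma dPvv u : u != 0 -> dP u u = 0.
Proof.
move=> u0; rewrite /dP expr2 divff ?subrr ?sqrtr0//.
by rewrite mulf_neq0// dotv_eq0.
Qed.

(** Write [w = k *: v + rej v w]. Subtracting [k] times the projection of [v] to [u] leaves
    [k *: rej u v + rej v w], and [rej_min] applies because [k *: v] is no longer than [w]. *)
Lemma dP_triangle u v w : u != 0 -> v != 0 -> w != 0 ->
  dP u w <= dP u v + dP v w.
Proof.
move=> u0 v0 w0.
have W : 0 < nrm w by rewrite nrm_gt0.
have V : 0 < nrm v by rewrite nrm_gt0.
rewrite -(ler_pM2l W).
have [k [kw kv]] : exists k, `|k| * nrm v <= nrm w /\ w = k *: v + rej v w.
  by exists (dotv v w / dotv v v); split; [rewrite -nrmZ nrm_rej_coef|exact: rejE].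
apply: le_trans (rej_min u w (k * (dotv u v / dotv u u)) u0) _.
rewrite {1}kv addrAC -scalerA -scalerBr.
apply: le_trans (nrmD _ _) _; rewrite nrm_rej// nrmZ -/(rej u v) nrm_rej//.
by rewrite mulrDr lerD2r mulrA ler_wpM2r ?dP_ge0.
Qed.

Lemma dP_eq0 u v : u != 0 -> dP u v = 0 -> exists c, v = c *: u.
Proof.
move=> u0 d0; exists (dotv u v / dotv u u).
apply/eqP; rewrite -subr_eq0 -nrm_eq0 -/(rej u v) nrm_rej// d0.
by rewrite mulr0.
Qed.

Lemma unit_neq0 u : nrm u = 1 -> u != 0.
Proof. by move=> u1; rewrite -nrm_eq0 u1 oner_eq0. Qed.

End Euclid.

(** * Spectral theorem for real symmetric matrices, by complexification *)

Section SymmetricSpectrum.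
Context {R : realType} {n : nat}.
Local Notation C := R[i].
Local Notation toC := (real_complex R).

Lemma char_poly_conj (F : fieldType) (P D : 'M[F]_n) : P \in unitmx ->
  char_poly (invmx P *m D *m P) = char_poly D.
Proof.
move=> Pu; rewrite /char_poly.
pose Q := map_mx polyC P; pose Qi := map_mx polyC (invmx P).
have QiQ : Qi *m Q = 1%:M by rewrite -map_mxM mulVmx// map_mx1.
have -> : char_poly_mx (invmx P *m D *m P) = Qi *m char_poly_mx D *m Q.
  rewrite /char_poly_mx mulmxBr mulmxBl !map_mxM; congr (_ - _).
  by rewrite scalar_mxC -mulmxA QiQ mulmx1.
by rewrite !det_mulmx mulrAC -det_mulmx QiQ det1 mul1r.
Qed.

(** Over the complex numbers [M] is hermitian, hence unitarily diagonalizable with real eigenvalues.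
    [P] passes to coordinates in an orthonormal eigenbasis, and the last item is Parseval's
    identity. *)
Lemma sym_spectral (M : 'M[R]_n) : M^T = M ->
  exists (P : 'M[C]_n) (d : 'I_n -> R),
  [/\ char_poly M = \prod_j ('X - (d j)%:P),
      forall (w : 'cV[R]_n) j, (P *m map_mx toC (M *m w)) j ord0 =
        toC (d j) * (P *m map_mx toC w) j ord0 &
      forall w a : 'cV[R]_n, toC (dotv w a) =
        \sum_j ((P *m map_mx toC w) j ord0)^* * (P *m map_mx toC a) j ord0].
Proof.
move=> Msym; pose A := map_mx toC M.
have Areal : A \is a mxOver Num.real.
  by apply/mxOverP => i j; rewrite mxE complex_real.
have Aherm : A \is hermsymmx.
  apply: realsym_hermsym => //; apply/is_hermitianmxP.
  by rewrite expr0 scale1r map_mx_id// map_trmx Msym.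
have /orthomx_spectralP AE := hermitian_normalmx Aherm.
have Dreal := hermitian_spectral_diag_real Aherm.
set P := spectralmx A in AE *; set D := spectral_diag A in AE Dreal *.
have Pu : P \in unitmx by exact: spectral_unit.
pose d j := complex.Re (D 0 j).
have dE j : toC (d j) = D 0 j by apply: RRe_real; exact: (mxOverP Dreal).
exists P, d; split.
- apply: (@map_poly_inj _ _ toC).
  rewrite map_char_poly -/A AE char_poly_conj// char_poly_trig ?diag_mx_is_trig//.
  rewrite rmorph_prod; apply: eq_bigr => j _.
  by rewrite /= rmorphB /= map_polyX map_polyC /= dE !mxE eqxx.
- move=> w j; rewrite map_mxM -/A mulmxA.
  have -> : P *m A = diag_mx D *m P by rewrite AE -!mulmxA mulKVmx.
  by rewrite -mulmxA mul_diag_mx mxE dE.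
- move=> w a.
  have PP : map_mx Num.conj P^T *m P = 1%:M.
    by rewrite -invmx_unitary ?spectral_unitarymx// mulVmx.
  have -> : toC (dotv w a) =
      ((map_mx Num.conj (P *m map_mx toC w)^T) *m (P *m map_mx toC a)) 0 0.
    rewrite trmx_mul map_mxM -mulmxA (mulmxA _ P) PP mul1mx mxE.
    rewrite rmorph_sum; apply: eq_bigr => j _; rewrite !mxE rmorphM.
    by congr (_ * _); rewrite /= conj_Creal// complex_real.
  by rewrite mxE; apply: eq_bigr => j _; rewrite !mxE.
Qed.

End SymmetricSpectrum.

(* [sg g] and [sg g * qq g] are the two largest singular values of [g]; these and
   later definitions are locked to keep unification from unfolding them. *)
HB.lock Definition sg {R : realType} {n : nat} (g : 'M[R]_n) : R := expR (mu g 0).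
HB.lock Definition qq {R : realType} {n : nat} (g : 'M[R]_n) : R := expR (- gap12 g).

(** * Singular values and the top singular direction *)

Section Singular.
Context {R : realType} {n : nat}.
Hypothesis n2 : (1 < n)%N.
Implicit Types (g h : 'M[R]_n) (u v w x : 'cV[R]_n).
Local Notation C := R[i].
Local Notation toC := (real_complex R).

Lemma sg_gt0 g : 0 < sg g. Proof. by rewrite sg.unlock expR_gt0. Qed.
Lemma qqE g : qq g = expR (- gap12 g). Proof. by rewrite qq.unlock. Qed.

Lemma qq_gt0 g : 0 < qq g. Proof. by rewrite qqE expR_gt0. Qed.

(** The sorted spectrum of [g *m g^T] exists, so the choice made in [mu] never falls back on the
    default [[::]]. *)
Lemma sq_sv_listP g : sq_sv_list g (xget [::] (sq_sv_list g)).
Proof.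
apply: xgetPex.
have Msym : (g *m g^T)^T = g *m g^T by rewrite trmx_mul trmxK.
have [P [d [cp _ _]]] := sym_spectral _ Msym.
exists (sort (fun b c : R => c <= b) [seq d j | j <- enum 'I_n]).
split; first by rewrite size_sort size_map size_enum_ord.
split; first by apply: sort_sorted => b c; apply: le_total.
rewrite cp (perm_big [seq d j | j <- enum 'I_n]) ?big_map ?big_enum//.
by rewrite perm_sort.
Qed.

(* The second singular value only enters through its action on the orthogonal
   complement of a top left singular vector [u]. *)
Lemma svd g : g \in unitmx ->
  exists u x0, [/\ nrm u = 1, nrm x0 = 1, g *m x0 = sg g *: u,
    (forall x, nrm (g *m x) <= sg g * nrm x) &
    (forall x, nrm (rej u (g *m x)) <= sg g * qq g * nrm x)].
Proof.
move=> gu; set M := g *m g^T.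
have Msym : M^T = M by rewrite trmx_mul trmxK.
have [ssz [ssrt sE]] := sq_sv_listP g.
rewrite sg.unlock qq.unlock /gap12 /mu; set s := xget _ _ in ssz ssrt sE *.
have [P [d [cp PM dotC]]] := sym_spectral _ Msym.
have [p sp] : exists p : 'I_n -> 'I_n, bijective p /\
    forall i : 'I_n, nth 0 s i = d (p i).
  have /perm.tuple_permP [p ps] : perm_eq s [tuple d i | i < n].
    apply: prod_XsubC_eq; rewrite -sE cp big_map.
    by rewrite big_enum.
  exists (perm.fun_of_perm p); split; first exact/injF_bij/perm.perm_inj.
  by move=> i; rewrite ps -tnth_nth !tnth_mktuple.
pose i0 := Ordinal (ltnW n2); pose i1 := Ordinal n2.
have [[pi piK pKi] dE] := sp.
have eigM j : exists2 a : 'cV[R]_n, a != 0 & M *m a = d j *: a.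
  have : root (char_poly M) (d j).
    by rewrite cp /root horner_prod (bigD1 j)//= !hornerE subrr mul0r.
  rewrite -eigenvalue_root_char => /eigenvalueP [v vM v0].
  exists v^T; first by rewrite trmx_eq0.
  by apply: trmx_inj; rewrite trmx_mul linearZ /= trmxK Msym.
have dotM w : dotv w (M *m w) = dotv (g^T *m w) (g^T *m w).
  by rewrite -mulmxA dotvC dotv_trmx.
have dpos j : 0 < d j.
  have [a a0 Ma] := eigM j.
  have : 0 < dotv a (M *m a).
    rewrite dotM dotv_gt0; apply: contra a0 => /eqP ga0.
    by rewrite -(mulKmx (_ : g^T \in unitmx) a) ?unitmx_tr// ga0 mulmx0.
  by rewrite Ma dotvZr pmulr_lgt0 // dotv_gt0.
have s0E : nth 0 s 0 = d (p i0) by exact: (dE i0).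
have s1E : nth 0 s 1 = d (p i1) by exact: (dE i1).
have sle (i j : nat) : (i <= j < n)%N -> nth 0 s j <= nth 0 s i.
  move=> /andP[ij jn].
  apply: (sorted_leq_nth _ _ 0 ssrt) => //.
  - by move=> ? ? ? xy yz; apply: le_trans yz xy.
  - by rewrite inE ssz (leq_ltn_trans ij).
  - by rewrite inE ssz.
have d_le0 j : d j <= nth 0 s 0.
  by rewrite -(pKi j) -dE sle//= ltn_ord.
have d_le1 j : j != p i0 -> d j <= nth 0 s 1.
  move=> jp; rewrite -(pKi j) -dE sle// ltn_ord andbT lt0n.
  by apply: contra jp => /eqP e; rewrite -(pKi j); apply/eqP; congr p; apply: val_inj.
have quad w (c : R) :
    (forall j, (P *m map_mx toC w) j ord0 != 0 -> d j <= c) ->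
    dotv w (M *m w) <= c * dotv w w.
  move=> H; rewrite -lecR (_ : (c * dotv w w)%:C%C = toC c * toC (dotv w w)); last first.
    by rewrite -rmorphM.
  rewrite !dotC mulr_sumr; apply: ler_sum => j _.
  rewrite PM mulrCA; have [->|Pw0] := eqVneq ((P *m map_mx toC w) j ord0) 0.
    by rewrite !mulr0.
  rewrite ler_wpM2r//; first by rewrite mulrC -normCK exprn_ge0.
  by rewrite lecR H.
have [a a0 Ma] := eigM (p i0).
have quad0 w : dotv w (M *m w) <= nth 0 s 0 * dotv w w by apply: quad => j _.
have quad1 w : dotv a w = 0 -> dotv w (M *m w) <= nth 0 s 1 * dotv w w.
  move=> aw; apply: quad => j Pwj; have [jp|] := eqVneq j (p i0); last exact: d_le1.
  (* Otherwise the top eigenvalue is simple, so [a] has only the coordinate [p i0]. As [w] has a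
     nonzero coordinate there, orthogonality forces [a = 0]. *)
  rewrite leNgt; apply/negP => s1lt.
  have Pa k : k != p i0 -> (P *m map_mx toC a) k ord0 = 0.
    move=> kp; have := PM a k.
    rewrite Ma map_mxZ -scalemxAr mxE => /eqP; rewrite -subr_eq0 -mulrBl mulf_eq0.
    rewrite -rmorphB => /orP[|/eqP//]; rewrite fmorph_eq0 subr_eq0 => /eqP dd.
    by have := d_le1 k kp; rewrite -dd -jp leNgt s1lt.
  have := dotC w a; rewrite dotvC aw (bigD1 (p i0))//= big1 => [|k /Pa ->]; last first.
    by rewrite mulr0.
  rewrite rmorph0 addr0 => /esym/eqP; rewrite mulf_eq0 conjC_eq0 -{1}jp (negbTE Pwj) /=.
  move=> /eqP Pa0; move: a0; rewrite -dotv_eq0 => /eqP; apply.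
  apply: (@complexI R); rewrite dotC rmorph0 big1// => k _.
  by have [->|/Pa->] := eqVneq k (p i0); rewrite ?Pa0 mulr0.
have half (b : R) : 0 < b -> expR (ln b / 2) ^+ 2 = b.
  by move=> b0; rewrite expr2 -expRD -splitr lnK.
have s0gt : 0 < nth 0 s 0 by rewrite s0E.
have s1gt : 0 < nth 0 s 1 by rewrite s1E.
have -> : expR (ln (nth 0 s 0) / 2) * expR (- (ln (nth 0 s 0) / 2 - ln (nth 0 s 1) / 2)) =
    expR (ln (nth 0 s 1) / 2) by rewrite -expRD opprB addrCA subrr addr0.
move: (half _ s0gt) (half _ s1gt).
move: (expR_gt0 (ln (nth 0 s 0) / 2)) (expR_gt0 (ln (nth 0 s 1) / 2)).
move: (expR (ln (nth 0 s 0) / 2)) (expR (ln (nth 0 s 1) / 2)) => b0 b1.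
move=> b0gt b1gt b0E b1E.
(* Duality carries a bound for [g^T] over to [g]: the square of [nrm w] is [dotv (g^T *m w) x], at
   most [b * nrm w * nrm x]. *)
have step b w x : 0 < b -> dotv w (M *m w) <= b ^+ 2 * dotv w w ->
    dotv w w = dotv w (g *m x) -> nrm w <= b * nrm x.
  move=> /ltW bge; rewrite dotM -!nrm_sq -exprMn.
  rewrite ler_pXn2r ?nnegrE ?nrm_ge0 ?mulr_ge0 ?nrm_ge0// => gw wE.
  have [->|w0] := eqVneq w 0; first by rewrite nrm0 mulr_ge0 ?nrm_ge0.
  rewrite -(ler_pM2l (_ : 0 < nrm w)) ?nrm_gt0// -expr2 wE.
  rewrite -{1}(trmxK g) -dotv_trmx mulrA.
  apply: le_trans (ler_norm _) (le_trans (CauchySchwarz _ _) _).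
  by rewrite ler_wpM2r ?nrm_ge0// mulrC.
pose u := (nrm a)^-1 *: a.
have na : 0 < nrm a by rewrite nrm_gt0.
have u1 : nrm u = 1 by rewrite nrmZ gtr0_norm ?invr_gt0// mulVf// gt_eqF.
have Mu : M *m u = b0 ^+ 2 *: u by rewrite -scalemxAr Ma b0E s0E scalerA mulrC -scalerA.
have unz := unit_neq0 _ u1.
exists u, (b0^-1 *: (g^T *m u)); split => //.
- rewrite nrmZ gtr0_norm ?invr_gt0// /nrm -dotM Mu dotvZr -nrm_sq u1 expr1n mulr1.
  by rewrite sqrtr_sqr gtr0_norm// mulVf// gt_eqF.
- by rewrite -scalemxAr mulmxA -/M Mu scalerA expr2 mulKf// gt_eqF.
- move=> x; apply: step => //; by rewrite b0E.
- move=> x; apply: step => //.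
    rewrite b1E; apply: quad1.
    have := dotv_rej u (g *m x) unz; rewrite {1}/u dotvZl => /eqP.
    by rewrite mulf_eq0 invr_eq0 (gt_eqF na) => /eqP.
  rewrite [X in _ = dotv _ X](rejE u); move: (rej _ _) (dotv_rej u (g *m x) unz) => r ur.
  by rewrite dotvDr dotvZr (dotvC r u) ur mulr0 add0r.
Qed.
End Singular.

(* Direction of the longest axis of the image of the unit ball under [g]. *)
HB.lock Definition uu {R : realType} {n : nat} (g : 'M[R]_n) : 'cV[R]_n :=
  xget 0 [set u | exists x0,
  [/\ nrm u = 1, nrm x0 = 1, g *m x0 = sg g *: u,
    (forall x, nrm (g *m x) <= sg g * nrm x) &
    (forall x, nrm (rej u (g *m x)) <= sg g * qq g * nrm x)]].

(** The condition number of [g], since [sg] is the operator norm. *)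
HB.lock Definition kap {R : realType} {n : nat} (g : 'M[R]_n) : R :=
  sg g * sg (invmx g).

(** * Top singular directions of products and distortion of lines *)

Section CartanProjection.
Context {R : realType} {n : nat}.
Hypothesis n2 : (1 < n)%N.
Implicit Types (g h A : 'M[R]_n) (u v w x y : 'cV[R]_n).

Lemma kapE g : kap g = sg g * sg (invmx g).
Proof. by rewrite kap.unlock. Qed.

Lemma uuP g : g \in unitmx -> exists x0,
  [/\ nrm (uu g) = 1, nrm x0 = 1, g *m x0 = sg g *: uu g,
    (forall x, nrm (g *m x) <= sg g * nrm x) &
    (forall x, nrm (rej (uu g) (g *m x)) <= sg g * qq g * nrm x)].
Proof. by move=> /(svd n2) E; rewrite uu.unlock; exact: (xgetPex 0 E). Qed.

Lemma nrm_uu g : g \in unitmx -> nrm (uu g) = 1.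
Proof. by move=> /uuP[x0 []]. Qed.

Lemma uu_neq0 g : g \in unitmx -> uu g != 0.
Proof. by move=> /nrm_uu/unit_neq0. Qed.

Lemma sg_top g : g \in unitmx ->
  exists2 x0, nrm x0 = 1 & g *m x0 = sg g *: uu g.
Proof. by move=> /uuP[x0 []]; exists x0. Qed.

Lemma sg_bound g x : g \in unitmx -> nrm (g *m x) <= sg g * nrm x.
Proof. by move=> /uuP[x0 []]. Qed.

Lemma rej_uu g x : g \in unitmx ->
  nrm (rej (uu g) (g *m x)) <= sg g * qq g * nrm x.
Proof. by move=> /uuP[x0 []]. Qed.

Lemma sg_lower g x : g \in unitmx -> nrm x <= sg (invmx g) * nrm (g *m x).
Proof.
by move=> gu; rewrite -{1}(mulKmx gu x) sg_bound// unitmx_inv.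
Qed.

Lemma mulmx_neq0 g x : g \in unitmx -> x != 0 -> g *m x != 0.
Proof.
by move=> gu; apply: contra => /eqP e; rewrite -(mulKmx gu x) e mulmx0.
Qed.

Lemma sg_nrm_top g x : g *m x = sg g *: uu g -> g \in unitmx ->
  nrm (g *m x) = sg g.
Proof. by move=> -> gu; rewrite nrmZ nrm_uu// mulr1 gtr0_norm ?sg_gt0. Qed.

Lemma sg_leP g (c : R) : g \in unitmx ->
  (forall x, nrm (g *m x) <= c * nrm x) -> sg g <= c.
Proof.
move=> gu H; have [x x1 gx] := sg_top _ gu.
by rewrite -(sg_nrm_top _ _ gx gu) -[c]mulr1 -x1.
Qed.

Lemma sgM g h : g \in unitmx -> h \in unitmx -> sg (g *m h) <= sg g * sg h.
Proof.
move=> gu hu; apply: sg_leP => [|x]; first by rewrite unitmx_mul gu.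
rewrite -mulmxA -mulrA; apply: le_trans (sg_bound _ _ gu) _.
by rewrite ler_wpM2l ?(ltW (sg_gt0 _))// sg_bound.
Qed.

Lemma sgMl g h : g \in unitmx -> h \in unitmx ->
  sg g <= sg (g *m h) * sg (invmx h).
Proof.
move=> gu hu; rewrite -{1}(mulmxK hu g) sgM ?unitmx_inv//.
by rewrite unitmx_mul gu.
Qed.

Lemma sgMr g h : g \in unitmx -> h \in unitmx ->
  sg h <= sg (invmx g) * sg (g *m h).
Proof.
move=> gu hu; rewrite -{1}(mulKmx gu h) sgM ?unitmx_inv//.
by rewrite unitmx_mul gu.
Qed.

Lemma kap_gt0 g : 0 < kap g. Proof. by rewrite kapE mulr_gt0 ?sg_gt0. Qed.

Lemma rejD v x y : rej v (x + y) = rej v x + rej v y.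
Proof.
by rewrite /rej dotvDr mulrDl scalerDl opprD addrACA.
Qed.

Lemma rejZ v (c : R) x : rej v (c *: x) = c *: rej v x.
Proof. by rewrite /rej dotvZr scalerBr scalerA mulrA. Qed.

(* A vector orthogonal to [uu g] exists because [1 < n]. *)
Lemma qq_kap_ge1 g : g \in unitmx -> 1 <= qq g * kap g.
Proof.
move=> gu; set u := uu g; have u0 : u != 0 by exact: uu_neq0.
have [y y0 uy] : exists2 y : 'cV[R]_n, y != 0 & dotv u y = 0.
  pose i0 := Ordinal (ltnW n2); pose i1 := Ordinal n2.
  have [ui|ui] := eqVneq (u i0 ord0) 0.
    exists (delta_mx i0 ord0).
      apply/eqP => /matrixP/(_ i0 ord0); rewrite !mxE !eqxx => /eqP.
      by rewrite oner_eq0.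
    rewrite /dotv (bigD1 i0)//= ui mul0r add0r big1// => j ji.
    by rewrite mxE (negbTE ji) mulr0.
  exists (u i1 ord0 *: delta_mx i0 ord0 - u i0 ord0 *: delta_mx i1 ord0).
    apply/eqP => /matrixP/(_ i1 ord0); rewrite !mxE !eqxx !andbT /= mulr0 mulr1 => /eqP.
    by rewrite sub0r oppr_eq0 (negbTE ui).
  have del i : dotv u (delta_mx i ord0) = u i ord0.
    rewrite /dotv (bigD1 i)//= mxE !eqxx mulr1 big1 ?addr0// => j ji.
    by rewrite mxE (negbTE ji) mulr0.
  by rewrite !dotvE !del mulrC subrr.
have ny : 0 < nrm y by rewrite nrm_gt0.
(* [y] equals its own rejection, so the second singular value bounds the stretch of [g] at
   [invmx g *m y]. *)
have := rej_uu g (invmx g *m y) gu.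
rewrite mulKVmx// /rej uy mul0r scale0r subr0 => H.
rewrite -(ler_pM2r ny) mul1r; apply: le_trans H _.
rewrite kapE mulrA [qq g * _]mulrC -[leRHS]mulrA.
by rewrite ler_wpM2l ?mulr_ge0 ?(ltW (sg_gt0 _)) ?(ltW (qq_gt0 _))// sg_bound ?unitmx_inv.
Qed.

Lemma dP_uu_image g x : g \in unitmx -> x != 0 ->
  dP (uu g) (g *m x) * nrm (g *m x) <= sg g * qq g * nrm x.
Proof.
by move=> gu x0; rewrite mulrC -nrm_rej ?uu_neq0// rej_uu.
Qed.

(** At a top vector [x] of [g *m h], the part of [g *m h *m x] off [uu g] is at most the second
    singular value of [g] times [sg h], while its full norm [sg (g *m h)] is at least
    [sg g / sg (invmx h)]. *)
Lemma dP_uu_mulr g h : g \in unitmx -> h \in unitmx ->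
  dP (uu g) (uu (g *m h)) <= kap h * qq g.
Proof.
move=> gu hu; have ghu : g *m h \in unitmx by rewrite unitmx_mul gu.
have [x x1 ghx] := sg_top _ ghu.
have x0 := unit_neq0 _ x1.
rewrite -(dPZr (sg (g *m h))) ?gt_eqF ?sg_gt0// -ghx.
have hx0 := mulmx_neq0 _ _ hu x0.
have H := dP_uu_image _ _ gu hx0.
rewrite mulmxA (sg_nrm_top _ _ ghx ghu) in H.
rewrite -(ler_pM2r (sg_gt0 (g *m h))); apply: le_trans H _.
have hx : nrm (h *m x) <= sg h by rewrite -[sg h]mulr1 -x1 sg_bound.
have := sgMl _ _ gu hu; rewrite kapE.
move: (nrm _) (sg_gt0 h) (qq_gt0 g) (sg_gt0 (invmx h)) (sg_gt0 g) hx.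
move: (sg h) (qq g) (sg (invmx h)) (sg g) (sg (g *m h)) => b q c a d e b0 q0 c0 a0 eb ad.
apply: (le_trans (y := a * q * b)); first exact: (ler_wpM2l (mulr_ge0 (ltW a0) (ltW q0))).
rewrite [leRHS](_ : _ = d * c * (q * b)); last by ring.
rewrite -mulrA; exact: (ler_wpM2r (mulr_ge0 (ltW q0) (ltW b0))).
Qed.

Lemma dP_mulmx g u v : g \in unitmx -> u != 0 -> v != 0 ->
  dP (g *m u) (g *m v) <= kap g * dP u v.
Proof.
move=> gu u0 v0; have gu0 := mulmx_neq0 _ _ gu u0; have gv0 := mulmx_neq0 _ _ gu v0.
have G : 0 < nrm (g *m v) by rewrite nrm_gt0.
rewrite -(ler_pM2l G).
apply: le_trans (rej_min _ _ (dotv u v / dotv u u) gu0) _.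
rewrite scalemxAr -mulmxBr -/(rej u v).
apply: le_trans (sg_bound _ _ gu) _; rewrite nrm_rej//.
rewrite kapE; have := sg_lower g v gu; have := dP_ge0 u v; have := sg_gt0 g.
move: (sg g) (nrm v) (dP u v) (sg (invmx g)) (nrm (g *m v)) => a b c k N a0 c0 H.
rewrite [leRHS](_ : _ = a * (k * N * c)); last by ring.
by apply: ler_wpM2l; [exact: ltW|exact: ler_wpM2r].
Qed.

(** For a top vector [x] of [g *m h], one factor [kap g] is the distortion of [dP] by [g]. The other
    compares [nrm (h *m x)] with [sg h], since [x] need not be a top vector of [h]. *)
Lemma dP_uu_mull g h : g \in unitmx -> h \in unitmx ->
  dP (g *m uu h) (uu (g *m h)) <= kap g ^+ 2 * qq h.
Proof.
move=> gu hu; have ghu : g *m h \in unitmx by rewrite unitmx_mul gu.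
have [x x1 ghx] := sg_top _ ghu.
have x0 := unit_neq0 _ x1; have hx0 := mulmx_neq0 _ _ hu x0.
rewrite -(dPZr (sg (g *m h))) ?gt_eqF ?sg_gt0// -ghx -mulmxA.
apply: le_trans (dP_mulmx _ _ _ gu (uu_neq0 _ hu) hx0) _.
rewrite expr2 -mulrA ler_wpM2l ?(ltW (kap_gt0 _))//.
have hx : 0 < nrm (h *m x) by rewrite nrm_gt0.
rewrite -(ler_pM2r hx); apply: le_trans (dP_uu_image _ _ hu x0) _; rewrite x1 mulr1.
have H1 := sgMr _ _ gu hu.
have H2 := sg_bound g (h *m x) gu; rewrite mulmxA (sg_nrm_top _ _ ghx ghu) in H2.
rewrite mulrC [X in _ <= X * _]mulrC -mulrA ler_wpM2l ?(ltW (qq_gt0 _))//.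
apply: le_trans H1 _; rewrite kapE [sg g * _]mulrC -mulrA ler_wpM2l ?(ltW (sg_gt0 _))//.
Qed.

(* If the line of [g v] is an almost attracting direction of [g], then passing
   from [g] to [A g] hardly changes the ratio between the norm of the matrix
   and its stretch along [v]. *)
Lemma growth A g v (eta : R) : A \in unitmx -> g \in unitmx -> v != 0 ->
  (forall x, nrm (rej (g *m v) (g *m x)) <= eta * sg g * nrm x) ->
  sg (A *m g) * nrm (g *m v) <=
    (1 + kap A * eta) * sg g * nrm (A *m (g *m v)).
Proof.
move=> Au gu v0 H; have Agu : A *m g \in unitmx by rewrite unitmx_mul Au.
have [x x1 Agx] := sg_top _ Agu.
have gv0 := mulmx_neq0 _ _ gu v0.
rewrite -{1}(sg_nrm_top _ _ Agx Agu) -mulmxA {1}(rejE (g *m v) (g *m x)).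
have := H x; have := nrm_rej_coef (g *m v) (g *m x) gv0.
have := sg_bound g x gu; rewrite x1 !mulr1.
move: (rej _ _) (_ / _) => r c G1 G2 G3.
have gvgt : 0 < nrm (g *m v) by rewrite nrm_gt0.
rewrite mulmxDr -scalemxAr.
apply: (le_trans (y := (`|c| * nrm (A *m (g *m v)) + sg A * (eta * sg g)) * nrm (g *m v))).
  rewrite ler_wpM2r ?nrm_ge0//; apply: le_trans (nrmD _ _) _; rewrite nrmZ lerD2l.
  by apply: le_trans (sg_bound _ _ Au) _; rewrite ler_wpM2l ?(ltW (sg_gt0 _)).
have eta0 : 0 <= eta.
  rewrite -(pmulr_lge0 _ (sg_gt0 g)).
  by apply: le_trans G3; exact: nrm_ge0.
rewrite nrmZ in G2.
have K1 : `|c| * nrm (g *m v) * nrm (A *m (g *m v)) <= sg g * nrm (A *m (g *m v)).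
  by rewrite ler_wpM2r ?nrm_ge0// (le_trans G2).
have K2 : sg A * (eta * sg g) * nrm (g *m v) <=
   sg A * (eta * sg g) * (sg (invmx A) * nrm (A *m (g *m v))).
  by rewrite ler_wpM2l ?mulr_ge0 ?(ltW (sg_gt0 _))// sg_lower.
have -> : (1 + kap A * eta) * sg g * nrm (A *m (g *m v)) =
  sg g * nrm (A *m (g *m v)) + sg A * (eta * sg g) * (sg (invmx A) * nrm (A *m (g *m v))).
  by rewrite kapE; ring.
by rewrite mulrDl mulrAC lerD.
Qed.

(** Split [g *m x] along [uu g]: the main part leaves the line of [v] by the factor [dP v (uu g)],
    and the rest is bounded by the second singular value. *)
Lemma rej_near_uu g v x : g \in unitmx -> v != 0 ->
  nrm (rej v (g *m x)) <= (dP v (uu g) + qq g) * sg g * nrm x.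
Proof.
move=> gu v0; have u0 := uu_neq0 _ gu.
rewrite (rejE (uu g) (g *m x)) rejD rejZ.
have := rej_uu g x gu; have := nrm_rej_coef (uu g) (g *m x) u0.
have := sg_bound g x gu.
move: (rej (uu g) _) (_ / _) => r c G1; rewrite nrmZ nrm_uu// mulr1 => G2 G3.
apply: le_trans (nrmD _ _) _; rewrite nrmZ nrm_rej// nrm_uu// mul1r.
have := nrm_rej_le v r v0; have := dP_ge0 v (uu g) => D0 D1.
rewrite !mulrDl lerD//; last by rewrite (le_trans D1)// (le_trans G3)// [qq g * _]mulrC.
by rewrite mulrC -mulrA ler_wpM2l// (le_trans G2).
Qed.

(** [uu (invmx g)] is the direction that [g] contracts most, to the length [1 / sg (invmx g)];
    [qq_kap_ge1] compares this with the second singular value. *)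
Lemma nrm_mul_uu_inv g : g \in unitmx ->
  nrm (g *m uu (invmx g)) <= qq g * sg g.
Proof.
move=> gu; have giu : invmx g \in unitmx by rewrite unitmx_inv.
have [x x1 gx] := sg_top _ giu.
have -> : g *m uu (invmx g) = (sg (invmx g))^-1 *: x.
  rewrite -[x](mulKVmx gu) gx -scalemxAr scalerA mulVf ?scale1r//.
  by rewrite gt_eqF ?sg_gt0.
rewrite nrmZ x1 mulr1 gtr0_norm ?invr_gt0 ?sg_gt0//.
rewrite -(ler_pM2r (sg_gt0 (invmx g))) mulVf ?gt_eqF ?sg_gt0// -mulrA -kapE.
exact: qq_kap_ge1.
Qed.

End CartanProjection.

(** The word length as a natural number, matched with [wlen] on the group by [wlenE]; the default
    [0] is the value outside the group. *)
HB.lock Definition len {R : realType} {n : nat} (S : seq 'M[R]_n) (g : 'M[R]_n) : nat :=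
  xget 0%N [set k | (exists w, [/\ is_word S w, word_eval w = g & size w = k]) /\
    forall w, is_word S w -> word_eval w = g -> (k <= size w)%N].

HB.lock Definition dist {R : realType} {n : nat} (S : seq 'M[R]_n) (p q : 'M[R]_n) : nat :=
  len S ((invmx p : 'M[R]_n) *m q).

(* Twice the Gromov product at the identity. *)
HB.lock Definition gro {R : realType} {n : nat} (S : seq 'M[R]_n) (p q : 'M[R]_n) : nat :=
  len S p + len S q - dist S p q.

(* [lia] from the natural number hypotheses only, with word lengths abstracted;
   it would otherwise spend its time inside matrix and real expressions. *)
Ltac nlia := repeat match goal with
  | H : is_true (leq _ _) |- _ => revert H
  | H : is_true (leq _ _ && leq _ _) |- _ => revert H
  | H : is_true (leq _ _) /\ is_true (leq _ _) |- _ => revert H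
  | H : @eq nat _ _ |- _ => revert H
  end; repeat match goal with
  | |- context [len ?S ?g] => generalize (len S g)
  | |- context [dist ?S ?g ?h] => generalize (dist S g h)
  | |- context [gro ?S ?g ?h] => generalize (gro S g h)
  end; clear; intros; lia.

(** * The word metric and its Gromov product *)

Section WordLength.
Context {R : realType} {n : nat} {S : seq 'M[R]_n}.
Hypothesis Sdet : all (fun g => \det g == 1) S.
Implicit Types (g h p q y z : 'M[R]_n).
Local Notation G := (in_gen S).
Local Notation len := (len S).
Local Notation dist := (dist S).
Local Notation gro := (gro S).

(* The type casts make products parse with one and the same ring structure. *)
Local Notation inv g := (invmx g : 'M[R]_n).

Lemma invmx_mulmx g h : g \in unitmx -> h \in unitmx ->
  invmx (g *m h) = inv h *m inv g.
Proof.
move=> gu hu; have ghu : g *m h \in unitmx by rewrite unitmx_mul gu.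
apply: (can_inj (mulKmx ghu)); rewrite mulmxV// -mulmxA (mulmxA h) mulmxV//.
by rewrite mul1mx mulmxV.
Qed.

Lemma letter_unit a : a \in S ++ map invmx S -> a \in unitmx.
Proof.
have H b : b \in S -> b \in unitmx.
  by move=> /(allP Sdet)/eqP; rewrite unitmxE => ->; rewrite unitr1.
by rewrite mem_cat => /orP[/H//|/mapP[b /H bu ->]]; rewrite unitmx_inv.
Qed.

Lemma letter_inv a : a \in S ++ map invmx S -> invmx a \in S ++ map invmx S.
Proof.
rewrite !mem_cat => /orP[aS|/mapP[b bS ->]]; first by rewrite map_f ?orbT.
by rewrite invmxK bS.
Qed.

Lemma word_eval_cat (w1 w2 : seq 'M[R]_n) :
  word_eval (w1 ++ w2) = word_eval w1 *m word_eval w2.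
Proof. by elim: w1 => [|a w IH] /=; rewrite ?mul1mx// IH mulmxA. Qed.

Lemma is_word_cat (w1 w2 : seq 'M[R]_n) :
  is_word S (w1 ++ w2) = is_word S w1 && is_word S w2.
Proof. exact: all_cat. Qed.

Lemma word_unit w : is_word S w -> word_eval w \in unitmx.
Proof.
elim: w => [|a w IH] /=; first by rewrite unitmx1.
by move=> /andP[/letter_unit au /IH wu]; rewrite unitmx_mul au.
Qed.

Lemma word_inv w : is_word S w ->
  exists w', [/\ is_word S w', word_eval w' = invmx (word_eval w) & size w' = size w].
Proof.
elim: w => [_|a w IH] /=; first by exists [::]; rewrite /= invmx1.
move=> /andP[aS wS]; have [w' [w'S w'E sw']] := IH wS.
exists (w' ++ [:: invmx a]); split.
- by rewrite is_word_cat w'S /= letter_inv.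
- by rewrite word_eval_cat /= mulmx1 w'E invmx_mulmx ?word_unit ?letter_unit.
- by rewrite size_cat sw' addn1.
Qed.

Lemma in_gen_unit g : G g -> g \in unitmx.
Proof. by case=> w [wS <-]; exact: word_unit. Qed.

Lemma in_gen1 : G 1%:M. Proof. by exists [::]. Qed.

Lemma in_genM g h : G g -> G h -> G (g *m h).
Proof.
case=> w [wS <-] [w' [w'S <-]]; exists (w ++ w').
by rewrite is_word_cat wS w'S word_eval_cat.
Qed.

Lemma in_genV g : G g -> G (invmx g).
Proof. by case=> w [/word_inv[w' [w'S w'E _]] <-]; exists w'. Qed.

Lemma in_genX g k : G g -> G (g ^+ k).
Proof.
move=> gG; elim: k => [|k IH]; first exact: in_gen1.
by rewrite exprS; exact: in_genM.
Qed.

Lemma len_spec g : G g -> (exists w, [/\ is_word S w, word_eval w = g & size w = len g]) /\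
    forall w, is_word S w -> word_eval w = g -> (len g <= size w)%N.
Proof.
case=> w0 [w0S w0E]; rewrite len.unlock.
pose Q k := (exists w, [/\ is_word S w, word_eval w = g & size w = k]) /\
    forall w, is_word S w -> word_eval w = g -> (k <= size w)%N.
suff /(xgetPex 0%N) : exists k, Q k by [].
pose P k := `[< exists w, [/\ is_word S w, word_eval w = g & size w = k] >].
have exP : exists k, P k by exists (size w0); apply/asboolP; exists w0.
exists (ex_minn exP); case: ex_minnP => k /asboolP kP kmin; split => // w wS wE.
by apply: kmin; apply/asboolP; exists w.
Qed.

Lemma len_word g : G g -> exists w, [/\ is_word S w, word_eval w = g & size w = len g].
Proof. by move=> /len_spec[]. Qed.

Lemma len_min w : is_word S w -> (len (word_eval w) <= size w)%N.
Proof.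
by move=> wS; have [|_] := len_spec (word_eval w); [exists w|apply].
Qed.

Lemma wlenE g : G g -> wlen S g = (len g)%:R.
Proof.
move=> gG; have [[w [wS wE sw]] lmin] := len_spec _ gG.
apply/eqP; rewrite eq_le; apply/andP; split.
  apply: ge_inf; last by exists w => //; rewrite sw.
  by exists 0 => _ [w' _ <-]; rewrite ler0n.
apply: lb_le_inf; first by exists (size w)%:R; exists w.
by move=> _ [w' [w'S w'E] <-]; rewrite ler_nat lmin.
Qed.

Lemma len1 : len 1%:M = 0%N.
Proof. by apply/eqP; rewrite -leqn0 -[1%:M]/(word_eval [::]) len_min. Qed.

Lemma lenM g h : G g -> G h -> (len (g *m h) <= len g + len h)%N.
Proof.
move=> /len_word[w [wS wE <-]] /len_word[w' [w'S w'E <-]].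
by rewrite -size_cat -wE -w'E -word_eval_cat len_min// is_word_cat wS.
Qed.

Lemma lenV g : G g -> len (invmx g) = len g.
Proof.
have H h : G h -> (len (invmx h) <= len h)%N.
  move=> /len_word[w [wS wE <-]]; have [w' [w'S w'E <-]] := word_inv _ wS.
  by rewrite -wE -w'E len_min.
by move=> gG; apply/eqP; rewrite eqn_leq H//= -{1}[g]invmxK H//; exact: in_genV.
Qed.

Lemma len_split g k : G g -> (k <= len g)%N ->
  exists y z, [/\ G y, G z, g = y *m z, len y = k & (len z = len g - k)%N].
Proof.
move=> gG; have [w [wS wE sw]] := len_word _ gG; move=> kg.
have := wS; rewrite -(cat_take_drop k w) is_word_cat => /andP[tS dS].
have E : g = word_eval (take k w) *m word_eval (drop k w).
  by rewrite -word_eval_cat cat_take_drop.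
have ty := len_min _ tS; have dy := len_min _ dS.
rewrite size_takel ?sw// in ty; rewrite size_drop sw in dy.
have tG : G (word_eval (take k w)) by exists (take k w).
have dG : G (word_eval (drop k w)) by exists (drop k w).
have := lenM _ _ tG dG; rewrite -E => H.
exists (word_eval (take k w)), (word_eval (drop k w)); split => //; lia.
Qed.

Lemma distE p q : dist p q = len (inv p *m q).
Proof. by rewrite dist.unlock. Qed.

Lemma distC p q : G p -> G q -> dist p q = dist q p.
Proof.
move=> pG qG; rewrite !distE -lenV; last by apply: in_genM => //; exact: in_genV.
by rewrite invmx_mulmx ?unitmx_inv ?in_gen_unit// invmxK.
Qed.

Lemma dist_triangle p q y : G p -> G q -> G y -> (dist p q <= dist p y + dist y q)%N.
Proof.
move=> pG qG yG; rewrite !distE.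
have -> : inv p *m q = (inv p *m y) *m (inv y *m q).
  by rewrite -mulmxA mulKVmx// in_gen_unit.
by apply: lenM; apply: in_genM => //; apply: in_genV.
Qed.

Lemma dist_mull y p q : G y -> G p -> dist (y *m p) (y *m q) = dist p q.
Proof.
move=> yG pG; rewrite !distE invmx_mulmx ?in_gen_unit// -mulmxA mulKmx//.
exact: in_gen_unit.
Qed.

Lemma dist1 p : G p -> dist 1%:M p = len p.
Proof. by move=> pG; rewrite distE invmx1 mul1mx. Qed.

Lemma distp1 p : G p -> dist p 1%:M = len p.
Proof. by move=> pG; rewrite distC ?dist1//; exact: in_gen1. Qed.

Lemma distpp p : G p -> dist p p = 0%N.
Proof. by move=> pG; rewrite distE mulVmx ?len1// in_gen_unit. Qed.

Lemma dist_len p q : G p -> G q -> [/\ (dist p q <= len p + len q)%N,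
  (len p <= len q + dist p q)%N & (len q <= len p + dist p q)%N].
Proof.
move=> pG qG; have G1 := in_gen1.
have := dist_triangle _ _ _ pG qG G1; have := dist_triangle _ _ _ G1 pG qG.
have := dist_triangle _ _ _ G1 qG pG.
by rewrite (distC q p)// !dist1// distp1//; split; lia.
Qed.

Lemma groE p q : G p -> G q -> (gro p q + dist p q = len p + len q)%N.
Proof. by move=> pG qG; rewrite gro.unlock; have [] := dist_len _ _ pG qG; lia. Qed.

Lemma groC p q : G p -> G q -> gro p q = gro q p.
Proof. by move=> pG qG; rewrite gro.unlock distC// addnC. Qed.

Lemma gprodE p q : G p -> G q -> gprod S p q = (gro p q)%:R / 2.
Proof.
move=> pG qG; rewrite /gprod !wlenE//; last by apply: in_genM => //; apply: in_genV.
by rewrite -distE -natrD -(groE _ _ pG qG) natrD addrK.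
Qed.

Lemma gro_le p q : G p -> G q -> (gro p q <= 2 * len p)%N /\ (gro p q <= 2 * len q)%N.
Proof.
move=> pG qG; have E := groE _ _ pG qG; have [? ? ?] := dist_len _ _ pG qG.
by split; lia.
Qed.

Lemma gropp p : G p -> (gro p p = 2 * len p)%N.
Proof. by move=> pG; have := groE _ _ pG pG; rewrite distpp//; lia. Qed.

(* Changing the base point from [1] to [y]. *)
Lemma gro_swap y p : G y -> G p ->
  (gro y (y *m p) + gro (invmx y) p = 2 * len y)%N.
Proof.
move=> yG pG; have yiG := in_genV _ yG; have ypG := in_genM _ _ yG pG.
have := groE _ _ yG ypG; have := groE _ _ yiG pG.
by rewrite !distE invmxK mulKmx ?in_gen_unit// lenV//; nlia.
Qed.

End WordLength.

(** * Contraction and growth of norms for a single step *)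

Section Constants.
Context {R : realType} {n : nat}.
Hypothesis n2 : (1 < n)%N.
Implicit Types (g h : 'M[R]_n).

Lemma kapM g h : g \in unitmx -> h \in unitmx -> kap (g *m h) <= kap g * kap h.
Proof.
move=> gu hu; rewrite !kapE invmx_mulmx//.
have := sgM n2 _ _ gu hu.
have := sgM n2 (invmx h) (invmx g); rewrite !unitmx_inv gu hu => /(_ isT isT) H1 H2.
rewrite mulrACA; have -> : sg g * sg h * (sg (invmx g) * sg (invmx h)) =
  sg g * sg h * (sg (invmx h) * sg (invmx g)) by ring.
by apply: ler_pM => //; exact/ltW/sg_gt0.
Qed.

Lemma kapV g : kap (invmx g) = kap g.
Proof. by rewrite !kapE invmxK mulrC. Qed.

(** A vector near the most contracted direction [uu (invmx g)] is contracted too: its component off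
    that direction has norm [dP (uu (invmx g)) v] and is stretched by at most [sg g]. *)
Lemma nrm_mul_near g (v : 'cV[R]_n) : g \in unitmx -> nrm v = 1 ->
  nrm (g *m v) <= (qq g + dP (uu (invmx g)) v) * sg g.
Proof.
move=> gu v1; have giu : invmx g \in unitmx by rewrite unitmx_inv.
have w0 := uu_neq0 n2 _ giu; have w1 := nrm_uu n2 _ giu.
have := nrm_mul_uu_inv n2 g gu; have := nrm_rej_coef (uu (invmx g)) v w0.
have := nrm_rej (uu (invmx g)) v w0.
have := rejE (uu (invmx g)) v.
rewrite v1 mul1r; move: (rej _ _) (_ / _) => r c vE rE; rewrite nrmZ w1 mulr1 => c1 gw.
rewrite {1}vE mulmxDr -scalemxAr mulrDl; apply: le_trans (nrmD _ _) _; rewrite nrmZ.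
apply: lerD; last by rewrite -rE [leRHS]mulrC; exact: sg_bound.
by apply: le_trans gw; rewrite ler_piMl// nrm_ge0.
Qed.

(** By [growth] one step costs a factor at most [expR (L * K * th ^+ t)]. The exponents form a
    geometric series, whose partial sums appear in the two bounds, so the total loss stays
    bounded. *)
Lemma growth_step (th L K : R) (t : nat) (A g : 'M[R]_n) (v : 'cV[R]_n) :
  0 < th -> th < 1 -> 0 <= K -> A \in unitmx -> g \in unitmx -> v != 0 ->
  kap A <= L ->
  (forall x, nrm (rej (g *m v) (g *m x)) <= K * th ^+ t * sg g * nrm x) ->
  sg g <= expR (L * K / (1 - th) * (1 - th ^+ t)) * nrm (g *m v) ->
  sg (A *m g) <= expR (L * K / (1 - th) * (1 - th ^+ t.+1)) * nrm (A *m g *m v).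
Proof.
move=> thgt thlt Kge Au gu v0 kA H IH.
have := growth n2 A g v _ Au gu v0 H; move: IH; rewrite -mulmxA.
have L0 : 0 <= L by apply: le_trans kA; exact/ltW/kap_gt0.
have gub : 0 < nrm (g *m v) by rewrite nrm_gt0 mulmx_neq0.
have Agub := nrm_ge0 (A *m (g *m v)).
have T0 : 0 <= K * th ^+ t by rewrite mulr_ge0 ?exprn_ge0 ?(ltW thgt).
have -> : L * K / (1 - th) * (1 - th ^+ t.+1) =
    L * K / (1 - th) * (1 - th ^+ t) + L * (K * th ^+ t).
  by rewrite exprS; field; rewrite subr_eq0 eq_sym lt_eqF.
rewrite expRD; move: (expR_gt0 (L * K / (1 - th) * (1 - th ^+ t))).
have := expR_ge1Dx (L * (K * th ^+ t)).
move: (expR (L * K / (1 - th) * (1 - th ^+ t))) (expR (L * (K * th ^+ t))) => e0 e1.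
move: (nrm (g *m v)) gub (nrm (A *m (g *m v))) Agub (K * th ^+ t) T0 (kap A) kA.
move=> N N0 N' N'0 T T0 k kL.
move: (sg g) (sg_gt0 g) (sg (A *m g)) => s1 s10 s2 le1 e00 s1le s2le.
rewrite -(ler_pM2r N0); apply: le_trans s2le _.
rewrite [leRHS](_ : _ = e1 * (e0 * N) * N'); last by ring.
apply: ler_wpM2r => //.
have e10 : 0 <= e1.
  by apply: le_trans le1; rewrite addr_ge0// mulr_ge0.
have k1 : 1 + k * T <= e1.
  by apply: le_trans le1; rewrite lerD2l ler_wpM2r.
apply: (le_trans (ler_wpM2r (ltW s10) k1)); exact: ler_wpM2l.
Qed.

End Constants.

(** * Anosov decay: convergence along geodesics, transversality, hyperbolicity *)

Section Anosov.
Context {R : realType} {n : nat} {S : seq 'M[R]_n}.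
Hypothesis n2 : (1 < n)%N.
Hypothesis Sdet : all (fun g => \det g == 1) S.
Implicit Types (g p q y z a b : 'M[R]_n).
Local Notation G := (in_gen S).
Local Notation len := (len S).
Local Notation dist := (dist S).
Local Notation gro := (gro S).
Local Notation inv g := (invmx g : 'M[R]_n).

Lemma anosov_qq : proj_anosov S ->
  exists K0 th : R, [/\ 0 < K0, 0 < th, th < 1 &
    forall g, G g -> qq g <= K0 * th ^+ len g].
Proof.
move=> [C [C' [C0 [C'0 H]]]]; exists (expR C'), (expR (- C)); split.
- exact: expR_gt0.
- exact: expR_gt0.
- by rewrite expR_lt1 oppr_lt0.
- move=> g gG; rewrite qqE -expRM_natl -expRD ler_expR.
  have := H g gG; rewrite wlenE//; lra.
Qed.

Lemma letters_kap : exists2 L : R, 1 <= L &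
  forall a, a \in S ++ map invmx S -> kap a <= L.
Proof.
elim: (S ++ map invmx S) => [|b s [L L1 HL]]; first by exists 1.
exists (Num.max L (kap b)); first by rewrite le_max L1.
by move=> a; rewrite inE le_max => /orP[/eqP->|/HL->//]; rewrite lexx orbT.
Qed.

Context {K0 th L : R}.
Hypothesis K0gt : 0 < K0.
Hypothesis thgt : 0 < th.
Hypothesis thlt : th < 1.
Hypothesis qqle : forall g, G g -> qq g <= K0 * th ^+ len g.
Hypothesis L1 : 1 <= L.
Hypothesis kapS : forall a, a \in S ++ map invmx S -> kap a <= L.

Let Gunit g : G g -> g \in unitmx := in_gen_unit Sdet g.
Let Lgt : 0 < L := lt_le_trans ltr01 L1.

Lemma kap_len g : G g -> kap g <= L ^+ len g.
Proof.
move=> gG; have [w [wS <- <-]] := len_word _ gG.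
elim: w wS => [_|a w IH] /=.
  have := qq_kap_ge1 n2 1%:M (unitmx1 _ _); rewrite expr0 kapE invmx1.
  have : sg (1%:M : 'M[R]_n) <= 1.
    by apply: (sg_leP n2); rewrite ?unitmx1// => x; rewrite mul1mx mul1r.
  by move=> s1 _; rewrite -[leRHS]mulr1 ler_pM ?(ltW (sg_gt0 _)).
move=> /andP[aS wS]; rewrite exprS.
apply: le_trans (kapM n2 _ _ (letter_unit Sdet _ aS) (word_unit Sdet _ wS)) _.
by rewrite ler_pM ?(ltW (kap_gt0 _))//; [exact: kapS|exact: IH].
Qed.

Lemma qq_lower g : G g -> (L ^+ len g)^-1 <= qq g.
Proof.
move=> gG; have Lg : 0 < L ^+ len g by rewrite exprn_gt0.
rewrite -[leLHS]mul1r ler_pdivrMr//; apply: le_trans (qq_kap_ge1 n2 _ (Gunit _ gG)) _.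
by rewrite ler_pM2l ?qq_gt0// kap_len.
Qed.

(** The sum of the series of [L * K0 * th ^+ t]: the total displacement of [uu] along a geodesic
    whose point number [t] has length at least [t]. *)
Definition chainK : R := L * K0 / (1 - th).

Let th1 : 0 < 1 - th. Proof. by rewrite subr_gt0. Qed.

Lemma chainK_gt0 : 0 < chainK. Proof. by rewrite /chainK divr_gt0// mulr_gt0. Qed.

Lemma th_mono (i j : nat) : (i <= j)%N -> th ^+ j <= th ^+ i.
Proof. by move=> ij; rewrite ler_wiXn2l// ltW. Qed.

Lemma dP_step y s : G y -> G s -> len s = 1%N ->
  dP (uu y) (uu (y *m s)) <= L * qq y.
Proof.
move=> yG sG s1; apply: le_trans (dP_uu_mulr n2 _ _ (Gunit _ yG) (Gunit _ sG)) _.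
by rewrite ler_pM2r ?qq_gt0//; have := kap_len _ sG; rewrite s1 expr1.
Qed.

(** The hypothesis forces point number [i] of a geodesic from [y] to [z] to have length at least
    [k + i], so the displacements of [uu] are dominated by a geometric series. *)
Lemma chain y z k : G y -> G z -> (dist y z + k <= len z)%N ->
  dP (uu y) (uu z) <= chainK * th ^+ k.
Proof.
move=> yG zG; have [d dE] : exists d, dist y z = d by exists (dist y z).
elim: d y k yG dE => [|d IH] y k yG dE lz.
  have yz : y = z.
    move: dE; rewrite distE => dE.
    have [w [_ wE]] := len_word (inv y *m z) (in_genM _ _ (in_genV Sdet _ yG) zG).
    rewrite dE => /size0nil w0; move: wE; rewrite w0 /= => /(congr1 (mulmx y)).
    by rewrite mulKVmx ?Gunit// mulmx1.
  by rewrite yz dPvv ?(uu_neq0 n2) ?Gunit// mulr_ge0 ?exprn_ge0 ?ltW ?chainK_gt0.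
have [s [r [sG rG E s1 rl]]] : exists s r, [/\ G s, G r, inv y *m z = s *m r,
    len s = 1%N & (len r = len (inv y *m z) - 1)%N].
  apply: len_split => //; first by apply: in_genM => //; exact: in_genV.
  by rewrite -distE dE.
have ysG := in_genM _ _ yG sG.
have d' : dist (y *m s) z = d.
  rewrite distE invmx_mulmx ?Gunit// -mulmxA E mulKmx ?Gunit// rl -distE dE; lia.
have yz0 := dP_triangle (uu y) (uu (y *m s)) (uu z).
apply: le_trans (yz0 _ _ _) _; rewrite ?(uu_neq0 n2) ?Gunit//.
have H := IH (y *m s) k.+1 ysG d'.
have {H} := H ltac:(nlia).
have := dP_step _ _ yG sG s1.
have : qq y <= K0 * th ^+ k.
  apply: le_trans (qqle _ yG) _; rewrite ler_pM2l// th_mono//.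
  by have [_ _] := dist_len Sdet _ _ yG zG; nlia.
rewrite exprS; set t := th ^+ k.
have -> : chainK * t = L * (K0 * t) + chainK * (th * t).
  by rewrite /chainK; field; rewrite gt_eqF.
by move=> q1 q2 q3; apply: lerD => //; apply: le_trans q2 _; rewrite ler_pM2l.
Qed.

(** With [h'] the Gromov product rounded down, cut a geodesic from [p] to [q] at distance
    [len p - h'] from [p]; [chain] applies from the cut point to both ends. *)
Lemma gro_dP p q (h : nat) : G p -> G q -> (2 * h <= gro p q)%N ->
  dP (uu p) (uu q) <= 2 * chainK * th ^+ h.
Proof.
move=> pG qG hg; have [h' h'E] : exists h', h' = (gro p q)./2 by eexists.
have hh : (h <= h')%N by nlia.
apply: (le_trans (y := 2 * chainK * th ^+ h')); last first.
  by rewrite ler_pM2l ?th_mono// mulr_gt0 ?chainK_gt0.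
have gE := groE Sdet _ _ pG qG; have [d1 d2 d3] := dist_len Sdet _ _ pG qG.
have gl := gro_le Sdet _ _ pG qG.
have hE : (2 * h' <= gro p q <= 2 * h' + 1)%N by nlia.
have pqG : G (inv p *m q) by apply: in_genM => //; exact: in_genV.
have tle : (len p - h' <= len (inv p *m q))%N by rewrite -distE; nlia.
have [s [r [sG rG E sl rl]]] := len_split Sdet _ _ pqG tle.
have psG := in_genM _ _ pG sG.
have D1 : dist (p *m s) p = (len p - h')%N.
  by rewrite distC// distE mulKmx ?Gunit.
have D2 : dist (p *m s) q = (dist p q - (len p - h'))%N.
  by rewrite distE invmx_mulmx ?Gunit// -mulmxA E mulKmx ?Gunit// rl -distE.
have yz0 := dP_triangle (uu p) (uu (p *m s)) (uu q).
apply: le_trans (yz0 _ _ _) _; rewrite ?(uu_neq0 n2) ?Gunit//.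
have c1 : dP (uu p) (uu (p *m s)) <= chainK * th ^+ h'.
  by rewrite dPC; apply: chain => //; rewrite D1; nlia.
have c2 : dP (uu (p *m s)) (uu q) <= chainK * th ^+ h'.
  by apply: chain => //; rewrite D2; nlia.
by rewrite -mulrA mulr_natl mulr2n lerD.
Qed.

Lemma geom_small (c e : R) : 0 < e -> exists m, c * th ^+ m < e.
Proof.
move=> e0; have [c0|c0] := leP c 0.
  exists 0%N; apply: le_lt_trans e0; by rewrite expr0 mulr1.
have : (fun k => th ^+ k) @ \oo --> (0 : R).
  by apply: cvg_expr; rewrite ger0_norm// ltW.
move=> /cvgrPdist_lt /(_ (e / c)); rewrite divr_gt0// => /(_ isT)[m _ /(_ m (leqnn m))] /=.
rewrite sub0r normrN ger0_norm ?exprn_ge0 ?ltW// => H; exists m.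
by rewrite mulrC -ltr_pdivlMr.
Qed.

(* Along the inverses [g_t] of the prefixes of [a], the image of [uu b] stays
   exponentially close to [uu g_t], so by [growth] it captures a definite
   proportion of the norm of [g_t]; if [uu b] were close to [uu a], it would be
   contracted instead. *)
Lemma transversality_growth a b (K : R) (m : nat) :
  G a -> G b -> dist a b = (len a + len b)%N -> (m <= len a)%N ->
  K = 2 * chainK + K0 -> L ^+ (2 * m) * K0 * th ^+ len b <= chainK * th ^+ m ->
  forall t y z, (t <= m)%N -> G y -> G z -> a = y *m z -> len y = t ->
    len z = (len a - t)%N ->
    sg (invmx y) <= expR (L * K / (1 - th) * (1 - th ^+ t)) * nrm (invmx y *m uu b).
Proof.
move=> aG bG ab ma KE Mb; have bu := Gunit _ bG.
have K0' : 0 < K by rewrite KE addr_gt0// mulr_gt0 ?chainK_gt0.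
elim=> [|t IH] y z tm yG zG aE yl zl.
  have -> : y = 1%:M.
    have [w [_ wE]] := len_word y yG.
    by rewrite yl => /size0nil w0; move: wE; rewrite w0.
  rewrite invmx1 mul1mx nrm_uu// expr0 subrr mulr0 expR0 mulr1.
  by apply: (sg_leP n2); rewrite ?unitmx1// => x; rewrite mul1mx mul1r.
have [y' [s [y'G sG yE y'l sl]]] : exists y' s, [/\ G y', G s, y = y' *m s,
    len y' = t & (len s = len y - t)%N].
  by apply: len_split => //; rewrite yl.
rewrite {}yl in sl; have {}sl : len s = 1%N by nlia.
have szG := in_genM _ _ sG zG.
have aE' : a = y' *m (s *m z) by rewrite mulmxA -yE.
have szl : len (s *m z) = (len a - t)%N.
  by have := lenM _ _ sG zG; have := lenM _ _ y'G szG; rewrite -aE'; nlia.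
have tm' : (t <= m)%N by nlia.
have {}IH := IH y' (s *m z) tm' y'G szG aE' y'l szl.
have y'b : dist y' b = (t + len b)%N.
  have := dist_triangle Sdet _ _ _ aG bG y'G.
  have -> : dist a y' = (len a - t)%N.
    by rewrite distC// distE {1}aE' mulKmx ?Gunit// szl.
  by have [] := dist_len Sdet _ _ y'G bG; nlia.
pose g := inv y'; have gG : G g by exact: in_genV.
have gu := Gunit _ gG; have gbG := in_genM _ _ gG bG.
pose A := inv s; have AG : G A by exact: in_genV.
have ub0 := uu_neq0 n2 _ bu.
have gub0 := mulmx_neq0 _ _ gu ub0.
(* [g *m uu b] is near [uu (g *m b)] because [b] is long, and [uu (g *m b)] is near [uu g] because,
   by [y'b], [g] lies on a geodesic from the identity to [g *m b]. *)
have near : dP (g *m uu b) (uu g) + qq g <= K * th ^+ t.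
  have D := dP_triangle (g *m uu b) (uu (g *m b)) (uu g) gub0
    (uu_neq0 n2 _ (Gunit _ gbG)) (uu_neq0 n2 _ gu).
  have D1 : dP (g *m uu b) (uu (g *m b)) <= chainK * th ^+ t.
    apply: le_trans (dP_uu_mull n2 _ _ gu bu) _.
    apply: (le_trans (y := L ^+ (2 * m) * (K0 * th ^+ len b))).
      apply: ler_pM; rewrite ?exprn_ge0 ?(ltW (qq_gt0 _)) ?(ltW (kap_gt0 _))//.
        rewrite kapV; apply: (le_trans (y := (L ^+ t) ^+ 2)).
          by rewrite ler_pXn2r ?nnegrE ?exprn_ge0 ?(ltW (kap_gt0 _)) ?(ltW Lgt)// -y'l kap_len.
        by rewrite -exprM ler_weXn2l//; nlia.
      exact: qqle.
    rewrite mulrA; apply: le_trans Mb _.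
    by rewrite ler_pM2l ?chainK_gt0// th_mono.
  have D2 : dP (uu (g *m b)) (uu g) <= chainK * th ^+ t.
    rewrite dPC; apply: chain => //.
    by rewrite distE mulKmx// -distE y'b; nlia.
  have := qqle _ gG; rewrite lenV// y'l; rewrite KE => D3; lra.
have H x : nrm (rej (g *m uu b) (g *m x)) <= K * th ^+ t * sg g * nrm x.
  apply: le_trans (rej_near_uu n2 _ _ _ gu gub0) _.
  by rewrite ler_wpM2r ?nrm_ge0// ler_pM2r ?sg_gt0.
have kA : kap A <= L by rewrite kapV; have := kap_len _ sG; rewrite sl expr1.
have -> : inv y = A *m g by rewrite yE invmx_mulmx ?Gunit.
by apply: growth_step => //; [exact: ltW|exact: Gunit].
Qed.

(** If [uu b] were within [th ^+ m] of [uu a], the inverse [g] of the prefix of [a] of length [m]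
    would shrink it to norm at most [(K0 + chainK + 1) * th ^+ m * sg g], against the lower bound
    [sg g / B] from [transversality_growth]. *)
Lemma transversality : exists (M : nat) (eps : R), 0 < eps /\
  forall a b, G a -> G b -> dist a b = (len a + len b)%N ->
    (M <= len a)%N -> (M <= len b)%N -> eps <= dP (uu a) (uu b).
Proof.
pose K := 2 * chainK + K0; pose B := expR (L * K / (1 - th)).
have Kgt1 := chainK_gt0; have Kgt : 0 < K by rewrite addr_gt0// mulr_gt0.
(* [m] makes the two bounds contradictory; [M0] then makes [b] long enough to absorb the distortion
   [L ^+ (2 * m)] caused by prefixes of length at most [m]. *)
have [m mE] := geom_small (B * (K0 + chainK + 1)) 1 ltr01.
have tm : 0 < th ^+ m by rewrite exprn_gt0.
have [M0 M0E] := geom_small (L ^+ (2 * m) * K0) (chainK * th ^+ m) (mulr_gt0 Kgt1 tm).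
exists (maxn m M0), (th ^+ m); split => // a b aG bG ab; rewrite !geq_max.
move=> /andP[ma _] /andP[_ Mb]; rewrite leNgt; apply/negP => dlt.
have [y [z [yG zG aE yl zl]]] := len_split Sdet _ _ aG ma.
have small : L ^+ (2 * m) * K0 * th ^+ len b <= chainK * th ^+ m.
  apply: le_trans (ltW M0E); rewrite ler_pM2l ?th_mono//.
  by rewrite mulr_gt0// exprn_gt0.
have H := transversality_growth _ _ K _ aG bG ab ma erefl small m y z (leqnn m) yG zG aE yl zl.
pose g := inv y; have gG : G g by exact: in_genV.
have ub1 : nrm (uu b) = 1 by rewrite nrm_uu// Gunit.
have near := nrm_mul_near n2 g (uu b) (Gunit _ gG) ub1.
rewrite /g invmxK in near.
have dyb : dP (uu y) (uu b) <= chainK * th ^+ m + th ^+ m.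
  apply: le_trans (dP_triangle _ (uu a) _ _ _ _) _; rewrite ?(uu_neq0 n2) ?Gunit//.
  apply: lerD (ltW dlt); apply: chain => //.
  by rewrite distE {1}aE mulKmx ?Gunit// zl; nlia.
have qg := qqle _ gG; rewrite lenV// yl in qg.
have : sg g <= B * ((K0 * th ^+ m + (chainK * th ^+ m + th ^+ m)) * sg g).
  apply: le_trans H _; apply: ler_pM; rewrite ?expR_ge0 ?nrm_ge0//.
    rewrite ler_expR ler_piMr ?divr_ge0 ?mulr_ge0 ?(ltW Kgt) ?(ltW Lgt) ?(ltW th1)//.
    by rewrite gerBl exprn_ge0// ltW.
  by apply: le_trans near _; rewrite ler_pM2r ?sg_gt0// lerD.
rewrite leNgt => /negP; apply.
rewrite [ltLHS](_ : _ = B * (K0 + chainK + 1) * th ^+ m * sg g); last by ring.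
by rewrite gtr_pMl ?sg_gt0.
Qed.

(* A form of Gromov hyperbolicity: a geodesic through the identity separates the
   points which the two halves fellow-travel. *)
Lemma hyperbolicity : exists2 h : nat, (0 < h)%N & forall a b a' b',
  G a -> G b -> G a' -> G b' -> dist a b = (len a + len b)%N ->
  (2 * h <= gro a a')%N -> (2 * h <= gro b b')%N -> (gro a' b' < 2 * h)%N.
Proof.
have [M [eps [eps0 sep]]] := transversality.
(* Going from [uu a] to [uu b] through [uu a'] and [uu b'] uses [gro_dP] three times, each at cost
   [2 * chainK * th ^+ h]. *)
have [m mE] := geom_small (6 * chainK) eps eps0.
exists (maxn m M).+1 => // a b a' b' aG bG a'G b'G ab.
set h := (maxn m M).+1 => ha hb.
rewrite ltnNge; apply/negP => hab.
have hm : (m <= h)%N by rewrite leqW// leq_maxl.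
have hM : (M <= h)%N by rewrite leqW// leq_maxr.
have [la _] := gro_le Sdet _ _ aG a'G; have [lb _] := gro_le Sdet _ _ bG b'G.
have Ma : (M <= len a)%N by nlia.
have Mb : (M <= len b)%N by nlia.
have := sep _ _ aG bG ab Ma Mb; apply/negP; rewrite -ltNge.
have aa := gro_dP _ _ _ aG a'G ha; have ab' := gro_dP _ _ _ a'G b'G hab.
have bb := gro_dP _ _ _ bG b'G hb; rewrite dPC in bb.
have t1 := dP_triangle (uu a) (uu a') (uu b); have t2 := dP_triangle (uu a') (uu b') (uu b).
rewrite !(uu_neq0 n2) ?Gunit// in t1 t2.
have {}t1 := t1 isT isT isT; have {}t2 := t2 isT isT isT.
apply: le_lt_trans mE; apply: (le_trans (y := 6 * chainK * th ^+ h)); first lra.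
by rewrite ler_pM2l ?th_mono// mulr_gt0 ?chainK_gt0.
Qed.

End Anosov.

(** * Infinite-order elements from repeated subwords of geodesics *)

Section Periodic.
Context {R : realType} {n : nat} {S : seq 'M[R]_n}.
Hypothesis Sdet : all (fun g => \det g == 1) S.
Implicit Types (g p q y z a b w : 'M[R]_n).
Local Notation G := (in_gen S).
Local Notation len := (len S).
Local Notation dist := (dist S).
Local Notation gro := (gro S).
Local Notation inv g := (invmx g : 'M[R]_n).
Local Notation Al := (S ++ map invmx S).

Let Gunit g : G g -> g \in unitmx := in_gen_unit Sdet g.

Lemma dist_inv y p : dist (inv y) p = len (y *m p).
Proof. by rewrite distE invmxK. Qed.

Lemma conv_infP (x : nat -> 'M[R]_n) : conv_inf S x <->
  (forall k, G (x k)) /\ forall m : nat, exists N, forall i j, (N <= i)%N -> (N <= j)%N ->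
    (m <= gro (x i) (x j))%N.
Proof.
split=> [[xG H]|[xG H]]; split => // m.
  have [N HN] := H (m%:R / 2); exists N => i j iN jN.
  have := HN i j iN jN; rewrite gprodE// -(ler_nat R).
  by rewrite ler_pM2r// invr_gt0.
have [N HN] := H (Num.truncn (2 * `|m|)).+1; exists N => i j iN jN.
rewrite gprodE// ler_pdivlMr// mulrC; apply: le_trans (ler_norm _) _.
rewrite normrM ger0_norm//; have := truncnS_gt (2 * `|m|) => /ltW/le_trans; apply.
by rewrite ler_nat HN.
Qed.

Lemma bconvP (x : nat -> nat -> 'M[R]_n) (y : nat -> 'M[R]_n) :
  (forall m i, G (x m i)) -> (forall j, G (y j)) ->
  (forall m : nat, exists m0, forall k, (m0 <= k)%N -> exists N, forall i j,
    (N <= i)%N -> (N <= j)%N -> (m <= gro (x k i) (y j))%N) -> bconv S x y.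
Proof.
move=> xG yG H M; have [m0 Hm0] := H (Num.truncn (2 * `|M|)).+1; exists m0 => k km.
have [N HN] := Hm0 k km; exists N => i j iN jN.
rewrite gprodE// ler_pdivlMr// mulrC; apply: le_trans (ler_norm _) _.
rewrite normrM ger0_norm//; have := truncnS_gt (2 * `|M|) => /ltW/le_trans; apply.
by rewrite ler_nat HN.
Qed.

Definition geod (u : seq 'M[R]_n) := is_word S u /\ len (word_eval u) = size u.

Lemma geod_in u : geod u -> G (word_eval u).
Proof. by case=> uS _; exists u. Qed.

Lemma geod_cat u v : geod (u ++ v) -> geod u /\ geod v.
Proof.
case; rewrite is_word_cat => /andP[uS vS] ; rewrite word_eval_cat size_cat => E.
have uG : G (word_eval u) by exists u.
have vG : G (word_eval v) by exists v.
have := lenM _ _ uG vG; have := len_min _ uS; have := len_min _ vS.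
by split; split => //; nlia.
Qed.

(** Pigeonhole on disjoint consecutive blocks of length [r] after position [s0], encoded by the
    indices of their letters; there is one more block than there are codes. *)
Lemma repeated_subword (W : seq 'M[R]_n) (s0 r : nat) : is_word S W ->
  (s0 + r * ((size Al).+1 ^ r).+2 <= size W)%N ->
  exists s t, [/\ (s0 <= s)%N, (s + r <= t)%N, (t + r <= size W)%N &
    take r (drop s W) = take r (drop t W)].
Proof.
move=> /allP WS; set N := ((size Al).+1 ^ r)%N => sW.
pose F (i : 'I_N.+1) : r.-tuple 'I_(size Al).+1 :=
  [tuple inord (index (nth 0 W (s0 + i * r + k)) Al) | k < r].
have [i [j [ij Fij]]] : exists i j : 'I_N.+1, (i < j)%N /\ F i = F j.
  have : ~~ injectiveb F.
    apply/negP => /injectiveP /leq_card; rewrite card_tuple !card_ord -/N.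
    by rewrite ltnn.
  move=> /injectivePn[i [j ij Fij]].
  have [lt|lt|/val_inj e] := ltngtP i j; first by exists i, j.
    by exists j, i.
  by rewrite e eqxx in ij.
have sz (i' : 'I_N.+1) : (s0 + i' * r + r <= size W)%N.
  by apply: leq_trans sW; have := ltn_ord i'; clear; nia.
exists (s0 + i * r)%N, (s0 + j * r)%N; split => //.
- exact: leq_addr.
- by move: ij; clear; nia.
have zi := sz i; have zj := sz j.
have szt m : (m + r <= size W)%N -> size (take r (drop m W)) = r.
  by move=> mr; rewrite size_takel// size_drop; lia.
apply: (@eq_from_nth _ 0); first by rewrite !szt.
move=> k; rewrite szt// => kr; rewrite !nth_take// !nth_drop.
have WA m : (m < size W)%N -> nth 0 W m \in Al by move=> mW; apply: WS; exact: mem_nth.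
have A1 : nth 0 W (s0 + i * r + k) \in Al by apply: WA; lia.
have A2 : nth 0 W (s0 + j * r + k) \in Al by apply: WA; lia.
have := congr1 (fun T => val (tnth T (Ordinal kr))) Fij.
rewrite !tnth_mktuple /= !inordK ?ltnS ?index_size// => E.
by rewrite -(nth_index 0 A1) E nth_index.
Qed.

Context {h : nat}.
Hypothesis h0 : (0 < h)%N.
Hypothesis hyp : forall a b a' b',
  G a -> G b -> G a' -> G b' -> dist a b = (len a + len b)%N ->
  (2 * h <= gro a a')%N -> (2 * h <= gro b b')%N -> (gro a' b' < 2 * h)%N.

Section Loxodromic.
Context {g w : 'M[R]_n}.
Hypothesis gG : G g.
Hypothesis wG : G w.
Hypothesis wl : (2 * h <= len w)%N.
Hypothesis wg : (dist w g + len w = len g)%N.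
Hypothesis gw : len (g *m w) = (len g + len w)%N.

Let giG : G (inv g). Proof. exact: in_genV. Qed.
Let gXG k : G (g ^+ k) := in_genX g k gG.

Let exprgS k : g ^+ k.+1 = g *m g ^+ k. Proof. by rewrite exprS. Qed.

Lemma len_expS k : (gro (inv g) (g ^+ k) + len (g ^+ k.+1) = len g + len (g ^+ k))%N.
Proof.
have := groE Sdet _ _ giG (gXG k); rewrite dist_inv -exprgS lenV//.
Qed.

(** The path from [w] to [g ^+ k.+1] through [g] shows that this product is at least [2 * len w]
    minus the cancellation in [g *m g ^+ k], hence at least [4 * h - 2 * h]. *)
Lemma gro_prefix_step k : (gro (inv g) (g ^+ k) < 2 * h)%N ->
  (2 * h <= gro w (g ^+ k.+1))%N.
Proof.
move=> IH; have := len_expS k.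
have := groE Sdet _ _ wG (gXG k.+1).
have := dist_triangle Sdet _ _ _ wG (gXG k.+1) gG.
have -> : dist g (g ^+ k.+1) = len (g ^+ k).
  by rewrite distE exprgS mulKmx// Gunit.
nlia.
Qed.

(** By [gw] the identity lies on a geodesic from [inv g] to [w], and [g ^+ k.+1] follows [w] by the
    previous lemma, so [hyp] separates it from [inv g]. The two bounds feed each other by
    induction. *)
Lemma gro_inv_exp k : (gro (inv g) (g ^+ k) < 2 * h)%N.
Proof.
elim: k => [|k IH].
  have := gro_le Sdet _ _ giG (gXG 0); rewrite expr0 -[1]/(1%:M) len1; nlia.
apply: (hyp (inv g) w) => //.
- by rewrite dist_inv lenV.
- by rewrite gropp// lenV//; nlia.
- exact: gro_prefix_step.
Qed.

Lemma gro_prefix k : (2 * h <= gro w (g ^+ k.+1))%N.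
Proof. exact/gro_prefix_step/gro_inv_exp. Qed.

Lemma len_exp_ge k : (k <= len (g ^+ k))%N.
Proof.
elim: k => // k IH; have := len_expS k; have := gro_inv_exp k; nlia.
Qed.

Lemma gro_exp_exp i k : (gro (inv (g ^+ i)) (g ^+ k) < 2 * h)%N.
Proof.
case: i => [|i].
  have -> : inv (g ^+ 0) = 1%:M by rewrite expr0 -[1]/(1%:M) invmx1.
  have := gro_le Sdet _ _ in_gen1 (gXG k); rewrite len1; nlia.
case: k => [|k].
  have := gro_le Sdet _ _ (in_genV Sdet _ (gXG i.+1)) (gXG 0).
  rewrite expr0 -[1]/(1%:M) len1; nlia.
apply: (hyp (inv g) w) => //; try exact: in_genV; first by rewrite dist_inv lenV.
  have := gro_swap Sdet _ _ giG (in_genV Sdet _ (gXG i)).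
  have -> : inv g *m inv (g ^+ i) = inv (g ^+ i.+1).
    by rewrite -invmx_mulmx ?Gunit// exprSr.
  rewrite lenV// invmxK.
  have := groE Sdet _ _ gG (in_genV Sdet _ (gXG i)).
  rewrite distE -invmx_mulmx ?Gunit// -[_ *m g]exprSr !lenV//.
  have := len_expS i; have := gro_inv_exp i; nlia.
exact: gro_prefix.
Qed.

(** Moving the base point to [g ^+ i] turns the small product of [inv (g ^+ i)] and [g ^+ (j - i)]
    into a large one at the identity. *)
Lemma gro_powers i j : (i <= j)%N -> (2 * i <= gro (g ^+ i) (g ^+ j) + 2 * h)%N.
Proof.
move=> ij; have := gro_swap Sdet _ _ (gXG i) (gXG (j - i)).
rewrite -[_ *m _]exprD subnKC// => E.
have := gro_exp_exp i (j - i); have := len_exp_ge i; nlia.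
Qed.

Lemma conv_inf_exp : conv_inf S (fun k => g ^+ k).
Proof.
apply/conv_infP; split => // m; exists (m + 2 * h)%N => i j iN jN.
case: (leqP i j) => [ij|/ltnW ij].
  by have := gro_powers _ _ ij; nlia.
by have := gro_powers _ _ ij; rewrite groC//; nlia.
Qed.

End Loxodromic.

(* A long geodesic towards [x j] contains some subword twice; the segment between
   the two occurrences spells an element [g] all of whose powers are geodesic up
   to a bounded error. *)
Lemma loxodromic_approx (x : nat -> 'M[R]_n) (m : nat) : conv_inf S x ->
  exists y g, [/\ G y, G g, conv_inf S (fun k => g ^+ k),
    (forall k, (k <= len (g ^+ k))%N) &
    (forall i j, (i <= j)%N -> (2 * i <= gro (g ^+ i) (g ^+ j) + 2 * h)%N) /\
    exists N, forall k j, (N <= j)%N ->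
      (2 * m <= gro (y *m g ^+ k.+1) (x j) + 4 * h)%N].
Proof.
move=> /conv_infP[xG xconv].
(* [s0] bounds the length of [y] from below, by [m] for the approximation and by [h] for [hyp]. The
   overlap [r] is what [wl] demands, and [R1] is the room for the pigeonhole plus a margin [h]. *)
pose s0 := maxn m h; pose r := (2 * h)%N.
pose R1 := (s0 + r * ((size Al).+1 ^ r).+2 + h)%N.
have [N HN] := xconv (2 * R1)%N; set z := x N.
have zG : G z by exact: xG.
have zl : (R1 <= len z)%N by have := HN N N (leqnn N) (leqnn N); rewrite gropp// -/z; nlia.
have [W0 [W0S W0E W0l]] := len_word z zG.
(* Only the initial part of the geodesic, fellow-travelled by all late [x j],
   is searched for a repetition. *)
pose W := take (R1 - h) W0.
have gW0 : geod W0 by split; rewrite // W0E.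
have Wl : size W = (R1 - h)%N by rewrite size_takel// W0l; nlia.
have gW : geod W by move: gW0; rewrite -{1}(cat_take_drop (R1 - h) W0) => /geod_cat[].
have [s [t [s0s srt trW Est]]] : exists s t, [/\ (s0 <= s)%N, (s + r <= t)%N,
    (t + r <= size W)%N & take r (drop s W) = take r (drop t W)].
  by apply: repeated_subword; [case: gW|rewrite Wl /R1; lia].
have tW0 : (t + r <= size W0)%N by rewrite W0l; move: trW zl; rewrite Wl; nlia.
have dropW u : (u + r <= size W)%N -> take r (drop u W) = take r (drop u W0).
  by move=> ur; rewrite /W !take_drop take_takel// -Wl addnC.
rewrite !dropW// in Est; last by lia.
pose A := take s W0; pose B := take (t - s) (drop s W0); pose D := drop t W0.
have W0ABD : W0 = A ++ B ++ D.
  rewrite /A /B /D -{1}(cat_take_drop s W0); congr (_ ++ _).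
  by rewrite -{1}(cat_take_drop (t - s) (drop s W0)) drop_drop subnK//; lia.
pose w := take r (drop t W0).
have Bw : B = w ++ drop r B.
  rewrite -{1}(cat_take_drop r B); congr (_ ++ _).
  by rewrite /w -Est /B take_takel//; lia.
have Dw : D = w ++ drop r D by rewrite /w /D cat_take_drop.
have Al' : size A = s by rewrite size_takel//; lia.
have Bl : size B = (t - s)%N by rewrite size_takel// size_drop; lia.
have wl : size w = r by rewrite size_takel// size_drop; lia.
have [gAll gBD] : geod A /\ geod (B ++ D) by apply: geod_cat; rewrite -W0ABD.
have [gB gD] := geod_cat _ _ gBD.
have gw : geod w by move: gD; rewrite Dw => /geod_cat[].
have gBw : geod (B ++ w) by move: gBD; rewrite {1}Dw catA => /geod_cat[].
have gAw : geod (A ++ w).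
  have : geod (A ++ B ++ D) by rewrite -W0ABD.
  by rewrite catA => /geod_cat[]; rewrite {1}Bw catA => /geod_cat[].
pose y := word_eval A; pose g := word_eval B; pose ww := word_eval w.
have yG : G y by exact: geod_in. have gG : G g by exact: geod_in.
have wG : G ww by exact: geod_in.
have yl : len y = s by rewrite gAll.2.
have gl : len g = (t - s)%N by rewrite gB.2.
have wwl : len ww = r by rewrite gw.2.
have wl2 : (2 * h <= len ww)%N by rewrite wwl.
have wg : (dist ww g + len ww = len g)%N.
  rewrite distE /g Bw word_eval_cat mulKmx ?Gunit// -word_eval_cat -Bw.
  have [_ ->] : geod (drop r B) by move: gB; rewrite {1}Bw => /geod_cat[].
  by rewrite -/g gl wwl size_drop Bl; lia.
have gww : len (g *m ww) = (len g + len ww)%N.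
  by rewrite /g /ww -word_eval_cat gBw.2 size_cat gB.2 gw.2.
have yww : len (y *m ww) = (len y + len ww)%N.
  by rewrite /y /ww -word_eval_cat gAw.2 size_cat gAll.2 gw.2.
exists y, g; split => //.
- exact: (conv_inf_exp gG wG).
- by move=> k; exact: (len_exp_ge gG wG).
split; first by move=> i j; exact: (gro_powers gG wG).
have yiG : G (inv y) by exact: in_genV.
have yself : (2 * h <= gro (inv y) (inv y))%N.
  rewrite gropp// lenV// yl; move: s0s; rewrite /s0; lia.
exists N => k j jN; pose p := g ^+ k.+1; have pG : G p by exact: in_genX.
have yxG : G (inv y *m x j) by apply: in_genM.
(* [E1] and [E2] bound the cancellation in [y *m p] and in [y *m (inv y *m x j)]. Both products
   therefore share the prefix [y] up to the final error [4 * h]. *)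
have E1 : (gro (inv y) p < 2 * h)%N.
  apply: (hyp (inv y) ww) => //; first by rewrite dist_inv lenV.
  exact: gro_prefix.
have zE : z = y *m word_eval (B ++ D) by rewrite -W0E {1}W0ABD word_eval_cat.
have bdG : G (word_eval (B ++ D)) by exact: geod_in.
have dyx : dist y (x j) = len (inv y *m x j) by rewrite distE.
have zlE : len z = (len y + len (word_eval (B ++ D)))%N.
  by rewrite yl gBD.2 -W0l W0ABD size_cat Al'.
have sR : (s + h <= R1)%N by move: srt trW; rewrite Wl; nlia.
have E2 : (gro (inv y) (inv y *m x j) < 2 * h)%N.
  apply: (hyp (inv y) (word_eval (B ++ D))) => //.
    by rewrite dist_inv -zE lenV.
  have H1 := HN N j (leqnn N) jN.
  have := groE Sdet _ _ bdG yxG; have := groE Sdet _ _ zG (xG j).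
  have -> : dist z (x j) = dist (word_eval (B ++ D)) (inv y *m x j).
    by rewrite -(dist_mull Sdet _ _ (inv y *m x j) yG bdG) -zE mulKVmx// Gunit.
  have [_ _] := dist_len Sdet _ _ yG (xG j); rewrite dyx; move: H1; rewrite -/z; nlia.
have ypG := in_genM _ _ yG pG.
have := groE Sdet _ _ yiG pG; have := groE Sdet _ _ yiG yxG.
rewrite !dist_inv mulKVmx ?Gunit// !lenV//.
have := groE Sdet _ _ ypG (xG j).
have := dist_triangle Sdet _ _ _ ypG (xG j) yG.
have -> : dist (y *m p) y = len p.
  by rewrite distC// distE mulKmx ?Gunit.
rewrite dyx -/p yl; move: s0s; rewrite /s0 geq_max => /andP[ms _]; nlia.
Qed.

End Periodic.

(** Compactness of the cube of row vectors with entries between [-1] and [1], transposed to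
    columns. *)
Lemma unit_cluster {R : realType} {n : nat} (u : nat -> 'cV[R]_n) :
  (forall k, nrm (u k) = 1) ->
  exists2 v : 'cV[R]_n, nrm v = 1 &
    forall (e : R) N, 0 < e -> exists2 k, (N <= k)%N & nrm (u k - v) < e.
Proof.
move=> u1; pose f k := (u k)^T.
have coord k i : `|u k i ord0| <= 1.
  rewrite -(u1 k) -[leLHS]sqrtr_sqr ler_wsqrtr// /dotv (bigD1 i)//= -expr2 lerDl.
  by apply: sumr_ge0 => j _; rewrite -expr2 sqr_ge0.
have cK := @rV_compact R n (fun=> `[-1, 1]%classic) (fun=> @segment_compact R _ _).
have [|p [_ pcl]] := cK (f @ \oo) _.
  by exists 0%N => // k _ i /=; rewrite /f mxE in_itv /= -ler_norml.
pose v := p^T.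
have near (e : R) N : 0 < e -> exists2 k, (N <= k)%N & nrm (u k - v) < e.
  move=> e0; have [d d0 dE] : exists2 d, 0 < d & n%:R * d < e.
    exists (e / n.+1%:R); first by rewrite divr_gt0.
    by rewrite mulrA ltr_pdivrMr// mulrC ltr_pM2l// ltr_nat.
  have [|q [[k Nk <-] pq]] := pcl (f @` [set k | (N <= k)%N]) (ball p d) _ (nbhsx_ballx p d d0).
    by exists N => // k /= Nk; exists k.
  exists k => //; apply: le_lt_trans dE.
  rewrite nrm_le ?mulr_ge0 ?(ltW d0)//.
  apply: (le_trans (y := \sum_(i < n) d ^+ 2)).
    apply: ler_sum => i _; rewrite -expr2 -real_normK ?num_real//.
    rewrite ler_pXn2r ?nnegrE ?(ltW d0)//.
    have := pq.2 ord0 i; rewrite /ball /= /f !mxE distrC => /ltW; exact.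
  rewrite sumr_const card_ord -[leLHS]mulr_natl exprMn ler_wpM2r ?sqr_ge0//.
  by rewrite -natrX ler_nat; clear; case: n => // m; nia.
exists v => //; apply/eqP; rewrite eq_le; apply/andP; split.
  apply/ler_addgt0Pl => e e0; have [k _ ke] := near e 0%N e0.
  have -> : v = - (u k - v) + u k by rewrite opprB subrK.
  by apply: le_trans (nrmD _ _) _; rewrite nrmN u1 lerD2r ltW.
apply/ler_addgt0Pl => e e0; have [k _ ke] := near e 0%N e0.
rewrite -(u1 k); have {1}-> : u k = (u k - v) + v by rewrite subrK.
by apply: le_trans (nrmD _ _) _; rewrite lerD2r ltW.
Qed.

Lemma dP_sub_le {R : realType} {n : nat} (u v : 'cV[R]_n) :
  u != 0 -> nrm v = 1 -> dP u v <= nrm (u - v).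
Proof.
move=> u0 v1; have := rej_min u v 1 u0.
by rewrite v1 mul1r scale1r -opprB nrmN.
Qed.

Lemma eigen_root {R : realType} {n : nat} (g : 'M[R]_n) (v : 'cV[R]_n) (c : R) :
  v != 0 -> g *m v = c *: v -> root (char_poly g) c.
Proof.
move=> v0 gv; rewrite -eigenvalue_root_char /eigenvalue /eigenspace kermx_eq0.
rewrite row_free_unit; apply: contra v0 => gu.
by rewrite -(mulKmx gu v) mulmxBl gv mul_scalar_mx subrr mulmx0.
Qed.

(** * The boundary map as a limit of top singular directions *)

Section LimitMap.
Context {R : realType} {n : nat} {S : seq 'M[R]_n}.
Hypothesis n2 : (1 < n)%N.
Hypothesis Sdet : all (fun g => \det g == 1) S.
Implicit Types (g p q y z : 'M[R]_n).
Local Notation G := (in_gen S).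
Local Notation len := (len S).
Local Notation dist := (dist S).
Local Notation gro := (gro S).
Local Notation inv g := (invmx g : 'M[R]_n).

Context {K0 th L : R}.
Hypothesis K0gt : 0 < K0.
Hypothesis thgt : 0 < th.
Hypothesis thlt : th < 1.
Hypothesis qqle : forall g, G g -> qq g <= K0 * th ^+ len g.
Hypothesis L1 : 1 <= L.
Hypothesis kapS : forall a, a \in S ++ map invmx S -> kap a <= L.
Local Notation K1 := (@chainK R K0 th L).

Let Gunit g : G g -> g \in unitmx := in_gen_unit Sdet g.
Let K1gt : 0 < K1 := chainK_gt0 K0gt thlt L1.
Let mono := th_mono thgt thlt.
Let uuG g : G g -> uu g != 0. Proof. by move=> /Gunit; exact: uu_neq0. Qed.
Let small := geom_small thgt thlt.

Lemma le0_geom (b c : R) : (forall k, b <= c * th ^+ k) -> b <= 0.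
Proof.
move=> H; rewrite leNgt; apply/negP => b0; have [m] := small c b b0.
by rewrite ltNge H.
Qed.

Context {h : nat}.

Section PowerLimit.
Context {g : 'M[R]_n}.
Hypothesis gG : G g.
Hypothesis len_pow : forall k, (k <= len (g ^+ k))%N.
Hypothesis gro_pow : forall i j, (i <= j)%N ->
  (2 * i <= gro (g ^+ i) (g ^+ j) + 2 * h)%N.

Let gXG k : G (g ^+ k) := in_genX g k gG.
Let Kp : R := 2 * K1 / th ^+ h.
Let Kpgt : 0 < Kp.
Proof. by rewrite divr_gt0 ?exprn_gt0// mulr_gt0. Qed.

Lemma qq_pow k : qq (g ^+ k) <= K0 * th ^+ k.
Proof.
by apply: le_trans (qqle _ (gXG k)) _; rewrite ler_pM2l// mono.
Qed.

(** [gro_pow] and [gro_dP] make the directions [uu (g ^+ k)] Cauchy with geometric rate, so a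
    cluster point is their limit. The denominator [th ^+ h] of [Kp] pays for the defect [2 * h] in
    [gro_pow]. *)
Lemma power_limit : exists2 v : 'cV[R]_n, nrm v = 1 &
  forall k, dP (uu (g ^+ k)) v <= Kp * th ^+ k.
Proof.
have [|v v1 vcl] := unit_cluster (fun k => uu (g ^+ k)).
  by move=> k; rewrite nrm_uu ?Gunit.
exists v => // k; apply/ler_addgt0Pl => e e0.
have [j kj je] := vcl e k e0.
have v0 := unit_neq0 _ v1.
apply: le_trans (dP_triangle _ (uu (g ^+ j)) _ (uuG _ (gXG k)) (uuG _ (gXG j)) v0) _.
rewrite addrC; apply: lerD.
  exact/ltW/(le_lt_trans _ je)/dP_sub_le/v1/uuG.
have gk : (2 * (k - h) <= gro (g ^+ k) (g ^+ j))%N by have := gro_pow _ _ kj; nlia.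
apply: le_trans (gro_dP n2 Sdet K0gt thgt thlt qqle L1 kapS _ _ _ (gXG k) (gXG j) gk) _.
rewrite [leRHS](_ : _ = 2 * K1 * (th ^+ k / th ^+ h)); last by rewrite /Kp mulrAC -mulrA.
have KK : 0 < 2 * K1 by rewrite mulr_gt0.
have thh : 0 < th ^+ h by rewrite exprn_gt0.
rewrite (ler_pM2l KK) (ler_pdivlMr _ _ thh).
by rewrite -exprD mono// addnC -leq_subLR.
Qed.

Lemma power_limit_eigen v : nrm v = 1 ->
  (forall k, dP (uu (g ^+ k)) v <= Kp * th ^+ k) -> exists c, g *m v = c *: v.
Proof.
move=> v1 H; have v0 := unit_neq0 _ v1; have gu := Gunit _ gG.
have gv0 := mulmx_neq0 _ _ gu v0.
apply: dP_eq0 => //; apply/eqP; rewrite eq_le dP_ge0 andbT.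
have kg := kap_gt0 g.
apply: (le0_geom _ (kap g * Kp + kap g ^+ 2 * K0 + Kp)) => k.
have gk0 := uuG _ (gXG k); have gk1 := uuG _ (gXG k.+1).
have ggk0 := mulmx_neq0 _ _ gu gk0.
have t1 := dP_triangle v (uu (g ^+ k.+1)) (g *m v) v0 gk1 gv0.
have t2 := dP_triangle (uu (g ^+ k.+1)) (g *m uu (g ^+ k)) (g *m v) gk1 ggk0 gv0.
have b1 : dP v (uu (g ^+ k.+1)) <= Kp * th ^+ k.
  rewrite dPC; apply: le_trans (H k.+1) _; rewrite ler_pM2l// mono//.
have b2 : dP (uu (g ^+ k.+1)) (g *m uu (g ^+ k)) <= kap g ^+ 2 * (K0 * th ^+ k).
  rewrite dPC exprS; apply: le_trans (dP_uu_mull n2 _ _ gu (Gunit _ (gXG k))) _.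
  by rewrite ler_pM2l ?exprn_gt0// qq_pow.
have b3 : dP (g *m uu (g ^+ k)) (g *m v) <= kap g * (Kp * th ^+ k).
  by apply: le_trans (dP_mulmx n2 _ _ _ gu gk0 v0) _; rewrite ler_pM2l.
apply: le_trans t1 _; rewrite addrC mulrDl; apply: lerD b1.
apply: le_trans t2 _; rewrite addrC mulrDl.
by rewrite -(mulrA (kap g) Kp) -(mulrA _ K0); exact: lerD b3 b2.
Qed.

(** Growth along the powers gives [sg (g ^+ k) <= B * c ^+ k] in absolute value, whereas [g ^+ k]
    pushes every vector towards [v] up to [K * th ^+ k * sg (g ^+ k)]. Applied to [w] and divided by
    the power of [lam], this makes [rej v w] vanish. *)
Lemma power_limit_unique v w c lam : nrm v = 1 ->
  (forall k, dP (uu (g ^+ k)) v <= Kp * th ^+ k) -> g *m v = c *: v ->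
  w != 0 -> g *m w = lam *: w -> c ^+ 2 <= lam ^+ 2 -> dP v w = 0.
Proof.
move=> v1 H gv w0 gw clam; have v0 := unit_neq0 _ v1; have gu := Gunit _ gG.
have powE (x : 'cV[R]_n) b k : g *m x = b *: x -> g ^+ k *m x = b ^+ k *: x.
  move=> gx; elim: k => [|k IH]; first by rewrite !expr0 scale1r -[1]/(1%:M) mul1mx.
  by rewrite exprS -[g * _]/(g *m _) -mulmxA IH -scalemxAr gx scalerA exprSr.
have c0 : c != 0.
  by apply/eqP => c0; move: (mulmx_neq0 _ _ gu v0); rewrite gv c0 scale0r eqxx.
pose K := Kp + K0; have Kgt : 0 < K by rewrite addr_gt0.
have near k x : nrm (rej v (g ^+ k *m x)) <= K * th ^+ k * sg (g ^+ k) * nrm x.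
  apply: le_trans (rej_near_uu n2 _ _ _ (Gunit _ (gXG k)) v0) _.
  rewrite ler_wpM2r ?nrm_ge0// ler_pM2r ?sg_gt0// mulrDl lerD ?qq_pow//.
  by rewrite dPC.
have rejc b x : b != 0 -> rej (b *: v) x = rej v x.
  move=> b0; rewrite /rej dotvZl dotvZl dotvZr scalerA; congr (_ - _ *: _).
  have vv : dotv v v != 0 by rewrite dotv_eq0.
  by field; rewrite vv.
have vpow k : g ^+ k *m v = c ^+ k *: v by exact: powE.
have bound k : sg (g ^+ k) <= expR (kap g * K / (1 - th) * (1 - th ^+ k)) * nrm (g ^+ k *m v).
  elim: k => [|k IH].
    rewrite expr0 -[1]/(1%:M) mul1mx v1 subrr mulr0 expR0 mulr1.
    by apply: (sg_leP n2); rewrite ?unitmx1// => x; rewrite mul1mx mul1r.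
  rewrite [g ^+ k.+1]exprS -[g * _]/(g *m _).
  apply: (growth_step n2) => //; [exact: ltW|exact: Gunit|move=> x].
  by rewrite vpow rejc ?expf_neq0.
pose B := expR (kap g * K / (1 - th)).
have lam0 : 0 < `|lam|.
  rewrite normr_gt0; apply: contraTneq clam => ->.
  by rewrite expr0n /= -ltNge exprn_even_gt0.
suff : nrm (rej v w) <= 0.
  by rewrite nrm_rej// pmulr_rle0 ?nrm_gt0// => d0; apply/eqP; rewrite eq_le d0 dP_ge0.
apply: (le0_geom _ (K * B * nrm w)) => k.
have lk : 0 < `|lam| ^+ k by rewrite exprn_gt0.
have := near k w; rewrite (powE w lam)// rejZ nrmZ normrX.
move=> /le_trans H1; rewrite -(ler_pM2l lk); apply: H1.
have sB : sg (g ^+ k) <= B * `|lam| ^+ k.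
  apply: le_trans (bound k) _; rewrite vpow nrmZ v1 mulr1 normrX.
  apply: ler_pM; rewrite ?expR_ge0 ?exprn_ge0//.
    rewrite ler_expR ler_piMr ?divr_ge0 ?mulr_ge0 ?(ltW Kgt) ?(ltW (kap_gt0 g)) ?subr_ge0 ?(ltW thlt)//.
    by rewrite gerBl exprn_ge0// ltW.
  apply: lerXn2r; rewrite ?nnegrE//.
  by rewrite -(@ler_pXn2r _ 2)// ?nnegrE// !real_normK ?num_real.
rewrite [leRHS](_ : _ = K * th ^+ k * (B * `|lam| ^+ k) * nrm w); last by ring.
by rewrite ler_wpM2r ?nrm_ge0// ler_pM2l// mulr_gt0 ?exprn_gt0.
Qed.

End PowerLimit.

Hypothesis h0 : (0 < h)%N.
Hypothesis hyp : forall a b a' b',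
  G a -> G b -> G a' -> G b' -> dist a b = (len a + len b)%N ->
  (2 * h <= gro a a')%N -> (2 * h <= gro b b')%N -> (gro a' b' < 2 * h)%N.
Context {xi : (nat -> 'M[R]_n) -> 'cV[R]_n}.
Hypothesis xiP : boundary_map S xi.

(** The eigenvalue on the limit line is a root of the characteristic polynomial, so the maximality
    of [lam] in [boundary_map] supplies the comparison that [power_limit_unique] asks for. *)
Lemma xi_power g : G g -> (forall k, (k <= len (g ^+ k))%N) ->
  (forall i j, (i <= j)%N -> (2 * i <= gro (g ^+ i) (g ^+ j) + 2 * h)%N) ->
  conv_inf S (fun k => g ^+ k) ->
  exists2 K : R, 0 < K & forall k, dP (uu (g ^+ k)) (xi (fun k => g ^+ k)) <= K * th ^+ k.
Proof.
move=> gG lp gp gconv; have [xi0 _ _ _ xiE] := xiP.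
have [v v1 vlim] := power_limit gG gp.
have [c gv] := power_limit_eigen gG lp v v1 vlim.
have v0 := unit_neq0 _ v1; have w0 := xi0 _ gconv.
have [|lam [gw lamP]] := xiE g gG.
  move=> k k0; apply: contraTneq (lp k) => ->.
  by rewrite -[1]/(1%:M) len1 -ltnNge.
have clam : c ^+ 2 <= lam ^+ 2.
  have := lamP (real_complex R c); rewrite fmorph_root => /(_ (eigen_root g v c v0 gv)).
  by rewrite /= expr0n addr0.
have d0 := power_limit_unique gG lp v _ c lam v1 vlim gv w0 gw clam.
exists (2 * K1 / th ^+ h); first by rewrite divr_gt0 ?exprn_gt0// mulr_gt0.
move=> k; have := dP_triangle _ _ _ (uuG _ (in_genX g k gG)) v0 w0.
by rewrite d0 addr0 => /le_trans; apply.
Qed.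

Lemma conv_inf_mull y (x : nat -> 'M[R]_n) : G y -> conv_inf S x ->
  conv_inf S (fun k => y *m x k).
Proof.
move=> yG /(conv_infP Sdet)[xG xc]; apply/(conv_infP Sdet); split.
  by move=> k; exact: in_genM.
move=> m; have [N HN] := xc (m + 2 * len y)%N; exists N => i j iN jN.
have yxi := in_genM _ _ yG (xG i); have yxj := in_genM _ _ yG (xG j).
have := groE Sdet _ _ yxi yxj; rewrite dist_mull//.
have := groE Sdet _ _ (xG i) (xG j); have := HN i j iN jN.
have yi := in_genV Sdet _ yG.
have := lenM _ _ yi yxi; have := lenM _ _ yi yxj.
rewrite !mulKmx ?Gunit// lenV//; nlia.
Qed.

(** Approximate [x] by translates [a m] of attracting points. Continuity controls [xi (a m)],
    equivariance and [xi_power] compare it with [uu (Y m *m F m ^+ k.+1)], and the latter is near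
    [uu (x j)] by [gro_dP]. *)
Lemma xi_limit (x : nat -> 'M[R]_n) (e : R) : conv_inf S x -> 0 < e ->
  exists N, forall j, (N <= j)%N -> dP (uu (x j)) (xi x) <= e.
Proof.
move=> xc e0; have [xi0 _ xiM xicont _] := xiP.
have xG : forall k, G (x k) by case: xc.
have [Y YP] := choice (fun m => loxodromic_approx Sdet h0 hyp x m xc).
have [F FP] := choice YP.
pose a m k := Y m *m F m ^+ k.
have YG m : G (Y m) by have [] := FP m.
have FG m : G (F m) by have [] := FP m.
have ac m : conv_inf S (a m) by apply: conv_inf_mull => //; have [] := FP m.
have abc : bconv S a x.
  apply: (bconvP Sdet) => // [m i|M].
    by apply: in_genM => //; exact: in_genX.
  exists (M + 2 * h)%N => m Mm; have [_ _ _ _ [_ [N HN]]] := FP m.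
  exists N.+1 => i j; case: i => // i iN jN; have := HN i j (ltnW jN).
  by rewrite /a; nlia.
have e3 : 0 < e / 3 by rewrite divr_gt0.
have [m1 m1P] := small (2 * K1) (e / 3) e3.
have := xicont a x xc ac abc; move=> /cvgrPdist_lt /(_ (e / 3) e3)[m2 _ m2P].
pose m := (maxn m1 m2 + 2 * h)%N.
have mm2 : (m2 <= m)%N by rewrite /m; apply: leq_trans (leq_addr _ _); exact: leq_maxr.
have {m2P} := m2P m mm2; rewrite /= sub0r normrN ger0_norm ?dP_ge0// => dax.
have [_ _ gconv lp [gp [N HN]]] := FP m.
have [K Kgt xiK] := xi_power _ (FG m) lp gp gconv.
have [am0 [w0 [c cE]]] := xiM (Y m) (fun k => F m ^+ k) (YG m) gconv.
have c0 : c != 0.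
  by apply: contraNneq am0 => c0; rewrite cE c0 scale0r.
have amE (v : 'cV[R]_n) : dP (xi (a m)) v = dP (Y m *m xi (fun k => F m ^+ k)) v.
  by rewrite /a cE dPZl.
exists N => j jN; have yu := Gunit _ (YG m).
have xij0 := xi0 _ xc; have xj0 := uuG _ (xG j).
have ky := kap_gt0 (Y m).
(* [N] is uniform in the exponent, so [k] can still be taken large enough to beat the distortion by
   [Y m]. *)
have [k kP] := small (kap (Y m) * K + kap (Y m) ^+ 2 * K0) (e / 3) e3.
pose g := F m ^+ k.+1; have gG : G g by exact: in_genX.
have ygG := in_genM _ _ (YG m) gG; have yg0 := uuG _ ygG.
have g0 := uuG _ gG; have xig0 := xi0 _ gconv.
have ymg0 := mulmx_neq0 _ _ yu g0.
have t1 := dP_triangle (uu (x j)) (uu (Y m *m g)) (xi x) xj0 yg0 xij0.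
have t2 := dP_triangle (uu (Y m *m g)) (Y m *m uu g) (xi x) yg0 ymg0 xij0.
have t3 := dP_triangle (Y m *m uu g) (xi (a m)) (xi x) ymg0 (xi0 _ (ac m)) xij0.
have b1 : dP (uu (x j)) (uu (Y m *m g)) <= e / 3.
  rewrite dPC; apply: le_trans (ltW m1P).
  have gm : (2 * (m - 2 * h) <= gro (Y m *m g) (x j))%N by have := HN k j jN; rewrite /g; nlia.
  apply: le_trans (gro_dP n2 Sdet K0gt thgt thlt qqle L1 kapS _ _ _ ygG (xG j) gm) _.
  have KK : 0 < 2 * K1 by rewrite mulr_gt0.
  by rewrite (ler_pM2l KK) mono// /m addnK leq_maxl.
have b2 : dP (uu (Y m *m g)) (Y m *m uu g) <= kap (Y m) ^+ 2 * K0 * th ^+ k.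
  rewrite dPC; apply: le_trans (dP_uu_mull n2 _ _ yu (Gunit _ gG)) _.
  rewrite -mulrA ler_pM2l ?exprn_gt0//; apply: le_trans (qqle _ gG) _.
  by rewrite ler_pM2l// mono// (leq_trans _ (lp k.+1)).
have b3 : dP (Y m *m uu g) (xi (a m)) <= kap (Y m) * K * th ^+ k.
  rewrite dPC amE dPC; apply: le_trans (dP_mulmx n2 _ _ _ yu g0 xig0) _.
  rewrite -mulrA ler_pM2l//; apply: le_trans (xiK k.+1) _.
  by rewrite ler_pM2l// mono.
rewrite mulrDl in kP.
move: dax kP t1 t2 t3 b1 b2 b3.
move: (dP _ _) (dP _ _) (dP _ _) (dP _ _) => *.
lra.
Qed.

End LimitMap.

(** * Bounding Hausdorff content by doubly indexed covers *)

Section HausdorffBound.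
Context {R : realType} {n : nat}.
Implicit Types (A U : set 'cV[R]_n) (s delta : R).

Lemma hterm_ge0 s U : (0 <= hterm s U)%E.
Proof. by rewrite /hterm; case: pselect => //= _; rewrite lee_fin powR_ge0. Qed.

Lemma diamP0 : diamP (set0 : set 'cV[R]_n) = -oo%E.
Proof.
rewrite /diamP (_ : [set _ | _ in _ & _ in _] = set0) ?ereal_sup0//.
by apply/seteqP; split => // x [u].
Qed.

Lemma hterm_le s U (d : R) : 0 <= s -> 0 <= d -> (diamP U <= d%:E)%E ->
  (hterm s U <= (d `^ s)%:E)%E.
Proof.
move=> s0 d0 Ud; rewrite /hterm; case: pselect => [_|U0] /=; first by rewrite lee_fin powR_ge0.
have [u Uu] : exists u, U u.
  by apply: contrapT => /forallNP H; apply: U0; apply/seteqP; split => // v /H.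
have D0 : (0 <= diamP U)%E.
  apply: (le_trans (y := (dP u u)%:E)); first by rewrite lee_fin dP_ge0.
  by apply: ereal_sup_ubound; exists u => //; exists u.
have Dfin : diamP U \is a fin_num.
  by rewrite fin_numE gt_eqF ?(lt_le_trans _ D0)// lt_eqF// (le_lt_trans Ud) ?ltry.
rewrite lee_fin ge0_ler_powR// ?nnegrE ?fine_ge0//.
by rewrite -lee_fin fineK.
Qed.

Lemma nneseries_le (a : nat -> \bar R) (B : \bar R) : (forall i, (0 <= a i)%E) ->
  (forall k, (\sum_(0 <= i < k) a i <= B)%E) -> (\sum_(i <oo) a i <= B)%E.
Proof.
move=> a0 H; apply: lime_le; first exact: is_cvg_nneseries.
by apply: nearW => k; exact: H.
Qed.

(** The cover is renumbered through [pickle], and nonnegativity allows the series to be regrouped by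
    [j]; at most [N j] sets contribute for each [j]. *)
Lemma hausdorff_content_pairs s delta A (W : nat -> nat -> set 'cV[R]_n)
    (N : nat -> nat) (b : nat -> R) (B : R) :
  (forall v, A v -> exists j k, W j k v) ->
  (forall j k, (diamP (W j k) <= delta%:E)%E) ->
  (forall j k, (N j <= k)%N -> W j k = set0) ->
  (forall j k, (hterm s (W j k) <= (b j)%:E)%E) ->
  (forall m, \sum_(0 <= j < m) (N j)%:R * b j <= B) ->
  (hausdorff_content s delta A <= B%:E)%E.
Proof.
move=> cov diam W0 hb sumB.
have b0 j : 0 <= b j by rewrite -lee_fin; apply: le_trans (hb j 0%N); exact: hterm_ge0.
pose Wp (p : nat * nat) := W p.1 p.2.
pose U i := if (pickle_inv i : option (nat * nat)) is Some p then Wp p else set0.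
have UE p : U (pickle p) = Wp p by rewrite /U pickleK_inv.
apply: (le_trans (y := \sum_(i <oo) hterm s (U i))%E).
  apply: ereal_inf_lbound; exists U => //; split.
    by move=> v /cov[j [k Wv]]; exists (pickle (j, k)) => //; rewrite UE.
  (* An index that codes no pair carries the empty set, whose diameter [-oo] meets any mesh
     bound. *)
  by move=> i; rewrite /U; case: pickle_inv => [p|]; [exact: diam|rewrite diamP0 leNye].
have hS0 : hterm s (set0 : set 'cV[R]_n) = 0%E by rewrite /hterm; case: pselect.
have h0 := hterm_ge0 s.
have -> : (\sum_(i <oo) hterm s (U i) = \sum_(j <oo) \sum_(k <oo) hterm s (W j k))%E.
  rewrite nneseries_esumT//.
  transitivity (\esum_(i in @pickle (nat * nat)%type @` setT) hterm s (U i))%E.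
    rewrite [RHS]esum_mkcond; apply: eq_esum => i _.
    case: ifPn => // /negP ni; rewrite /U; case E : (pickle_inv i) => [p|//].
    exfalso; apply: ni; rewrite inE; exists p => //.
    by move: E; rewrite /pickle_inv; case: unpickle => //= q; case: ifP => // /eqP <- [<-].
  rewrite esum_image; last first.
    by move=> p q _ _; exact: (pcan_inj pickleK).
  rewrite [RHS]nneseries_esumT; last by move=> j; exact: nneseries_ge0.
  transitivity (\esum_(j in [set: nat]) \esum_(k in [set: nat]) hterm s (W j k))%E; last first.
    by apply: eq_esum => j _; rewrite nneseries_esumT.
  rewrite esum_esum; last by move=> j k _ _; exact: h0.
  set D := (_ `*`` _).
  have -> : D = setT by apply/seteqP; split.
  by apply: eq_esum => p _; rewrite UE.
apply: nneseries_le => [j|m]; first exact: nneseries_ge0.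
apply: (le_trans (y := (\sum_(0 <= j < m) (N j)%:R * b j)%:E)); last by rewrite lee_fin.
rewrite -sumEFin; apply: lee_sum => j _.
apply: nneseries_le => // k.
apply: (le_trans (y := \sum_(0 <= i < k) (if (i < N j)%N then (b j)%:E else 0))%E).
  apply: lee_sum => i _; case: ltnP => // Ni.
  by rewrite W0// hS0.
have -> : (\sum_(0 <= i < k) (if (i < N j)%N then (b j)%:E else 0) =
    ((minn k (N j))%:R * b j)%:E)%E.
  elim: k => [|k IH]; first by rewrite big_geq// min0n mul0r.
  rewrite big_nat_recr//= IH; case: ltnP => kN.
    rewrite -EFinD (minn_idPl kN).
    by rewrite -natr1 mulrDl mul1r.
  by rewrite adde0 (minn_idPr (leqW kN)).
by rewrite lee_fin ler_wpM2r// ler_nat geq_minr.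
Qed.

End HausdorffBound.

(** * Covering limit points by balls of radius comparable to [qq] *)

Section Cover.
Context {R : realType} {n : nat} {S : seq 'M[R]_n}.
Hypothesis n2 : (1 < n)%N.
Hypothesis Sdet : all (fun g => \det g == 1) S.
Implicit Types (g p q y z : 'M[R]_n).
Local Notation G := (in_gen S).
Local Notation len := (len S).

Context {K0 th L : R}.
Hypothesis K0gt : 0 < K0.
Hypothesis thgt : 0 < th.
Hypothesis thlt : th < 1.
Hypothesis qqle : forall g, G g -> qq g <= K0 * th ^+ len g.
Hypothesis L1 : 1 <= L.
Hypothesis kapS : forall a, a \in S ++ map invmx S -> kap a <= L.

Let Gunit g : G g -> g \in unitmx := in_gen_unit Sdet g.

Lemma nat_argmax (f : nat -> R) (a b : nat) : (a <= b)%N ->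
  exists k, (a <= k <= b)%N /\ forall t, (a <= t <= b)%N -> f t <= f k.
Proof.
move=> ab; rewrite -(subnKC ab); elim: (b - a)%N => [|d [k [/andP[ak kd] kmax]]].
  by exists a; rewrite addn0 leqnn; split => // t; rewrite -eqn_leq => /eqP <-.
have [le|/ltW le] := leP (f (a + d.+1)%N) (f k).
  exists k; rewrite ak addnS leqW//; split => // t /andP[at_]; rewrite leq_eqVlt.
  by move=> /orP[/eqP->|td]; [rewrite -addnS|rewrite kmax// at_].
exists (a + d.+1)%N; rewrite leqnn leq_addr; split => // t /andP[at_]; rewrite leq_eqVlt.
move=> /orP[/eqP->//|td]; apply: le_trans le; apply: kmax.
by rewrite at_ -ltnS -addnS.
Qed.

Section Ray.
Context {tau : R} {W : seq 'M[R]_n}.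
Hypothesis tau1 : tau < 1.
Hypothesis WG : geod (S := S) W.
Let gam t := word_eval (take t W).
Let gamG t : G (gam t).
Proof.
by exists (take t W); split => //; have [/allP WS _] := WG; apply/allP => a /mem_take/WS.
Qed.

Lemma len_ray t : (t <= size W)%N -> len (gam t) = t.
Proof.
move=> tW; have := @geod_cat _ _ S (take t W) (drop t W).
rewrite cat_take_drop => /(_ WG)[[_ E] _].
by rewrite /gam E size_takel.
Qed.

Lemma ray_step t : (t < size W)%N ->
  dP (uu (gam t)) (uu (gam t.+1)) <= L * qq (gam t).
Proof.
move=> tW; have aS : nth 0 W t \in S ++ map invmx S.
  by have [/allP WS _] := WG; apply: WS; exact: mem_nth.
have -> : gam t.+1 = gam t *m nth 0 W t.
  by rewrite /gam (take_nth 0 tW) -cats1 word_eval_cat /= mulmx1.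
apply: le_trans (dP_uu_mulr n2 _ _ (Gunit _ (gamG t)) (letter_unit Sdet _ aS)) _.
by rewrite ler_pM2r ?qq_gt0// kapS.
Qed.

Lemma ray_sum k i : (k + i <= size W)%N ->
  (forall t, (k <= t <= size W)%N -> qq (gam t) <= qq (gam k) * tau ^+ (t - k)) ->
  dP (uu (gam k)) (uu (gam (k + i))) <= L * qq (gam k) * ((1 - tau ^+ i) / (1 - tau)).
Proof.
move=> + H; have gu t := uu_neq0 n2 _ (Gunit _ (gamG t)).
elim: i => [|i IH] ki.
  by rewrite addn0 dPvv// expr0 subrr mul0r mulr0.
have ki' : (k + i < size W)%N by rewrite -addnS.
have := dP_triangle _ _ _ (gu k) (gu (k + i)%N) (gu (k + i.+1)%N).
move=> /le_trans; apply.
have -> : (1 - tau ^+ i.+1) / (1 - tau) = (1 - tau ^+ i) / (1 - tau) + tau ^+ i.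
  by rewrite exprS; field; rewrite subr_eq0 eq_sym lt_eqF.
rewrite mulrDr; apply: lerD; first exact/IH/ltnW.
rewrite addnS; apply: le_trans (ray_step _ ki') _.
rewrite -mulrA ler_pM2l ?(lt_le_trans ltr01)//.
by have := H (k + i)%N; rewrite leq_addr (ltnW ki') addKn; apply.
Qed.

End Ray.

Context {h : nat}.
Hypothesis h0 : (0 < h)%N.
Hypothesis hyp : forall a b a' b',
  G a -> G b -> G a' -> G b' -> dist S a b = (len a + len b)%N ->
  (2 * h <= gro S a a')%N -> (2 * h <= gro S b b')%N -> (gro S a' b' < 2 * h)%N.
Context {xi : (nat -> 'M[R]_n) -> 'cV[R]_n}.
Hypothesis xiP : boundary_map S xi.

(* On a geodesic towards [x j], the element [gam k] is chosen so that the gap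
   grows at least at half the Anosov rate after time [k]; the displacement of
   [uu] after [k] is then dominated by [qq (gam k)] alone. *)
Lemma limit_point_cover : exists2 K : R, 0 < K &
  forall x N, conv_inf S x ->
    exists g, [/\ G g, (N <= len g)%N & dP (uu g) (xi x) <= K * qq g].
Proof.
pose tau := Num.sqrt th.
have tau0 : 0 < tau by rewrite sqrtr_gt0.
have tau2 : tau ^+ 2 = th by rewrite sqr_sqrtr// ltW.
have tau1 : tau < 1 by rewrite -sqrtr1 ltr_sqrt.
have Lgt : 0 < L by exact: lt_le_trans L1.
exists (L / (1 - tau) + 1) => [|x N xc].
  by rewrite addr_gt0// divr_gt0// subr_gt0.
pose c0 := (L ^+ N)^-1; have c0gt : 0 < c0 by rewrite invr_gt0 exprn_gt0.
(* A lower bound for [qq (gam k)] that is known before [j] and [k] are chosen: maximality will give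
   [c0 * tau ^+ k <= qq (gam k)], and the Anosov bound [qq (gam k) <= K0 * tau ^+ (2 * k)] then
   gives [c0 / K0 <= tau ^+ k]. *)
pose eta := c0 ^+ 2 / K0; have eta0 : 0 < eta by rewrite divr_gt0 ?exprn_gt0.
have [N1 N1P] := xi_limit n2 Sdet K0gt thgt thlt qqle L1 kapS h0 hyp xiP x eta xc eta0.
have /(conv_infP Sdet)[xG xgro] := xc; have [N2 N2P] := xgro (2 * N)%N.
pose j := maxn N1 N2; pose z := x j.
have zG : G z by exact: xG.
have zN : (N <= len z)%N.
  by have := N2P j j (leq_maxr _ _) (leq_maxr _ _); rewrite gropp// -/z; nlia.
have dz : dP (uu z) (xi x) <= eta by apply: N1P; exact: leq_maxl.
have [W [WS WE Wl]] := len_word z zG.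
have gW : geod (S := S) W by split => //; rewrite WE Wl.
pose gam t := word_eval (take t W).
have gamG t : G (gam t).
  by exists (take t W); split => //; apply/allP => a /mem_take; apply/allP.
rewrite -Wl in zN.
(* Maximizing the ratio to [tau ^+ t] is exactly what makes [qq] decay at rate [tau] after [k]. *)
have [k [/andP[Nk kW] kmax]] := nat_argmax (fun t => qq (gam t) / tau ^+ t) _ _ zN.
have tk t : 0 < tau ^+ t by rewrite exprn_gt0.
have decay t : (k <= t <= size W)%N -> qq (gam t) <= qq (gam k) * tau ^+ (t - k).
  move=> /andP[kt tW]; have := kmax t; rewrite (leq_trans Nk kt) tW => /(_ isT).
  rewrite ler_pdivrMr// => /le_trans; apply.
  rewrite -{1}(subnKC kt) exprD mulrA divfK// gt_eqF//.
have kl : len (gam k) = k by exact: len_ray.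
have qk : eta <= qq (gam k).
  have Nl : len (gam N) = N by exact: len_ray.
  have cN : c0 <= qq (gam N).
    by have := qq_lower n2 Sdet L1 kapS _ (gamG N); rewrite Nl.
  have q1 : c0 * tau ^+ k <= qq (gam k).
    rewrite -ler_pdivlMr//; have := kmax N; rewrite leqnn zN => /(_ isT).
    apply: le_trans; apply: le_trans cN _; rewrite ler_pdivlMr// ler_piMr ?(ltW (qq_gt0 _))//.
    by rewrite exprn_ile1 ?ltW.
  have q2 := qqle _ (gamG k); rewrite kl -tau2 -exprM mulnC exprM in q2.
  have ck : c0 / K0 <= tau ^+ k.
    rewrite ler_pdivrMr// -(ler_pM2r (tk k)); apply: le_trans q1 _.
    by apply: le_trans q2 _; rewrite expr2 mulrA [tau ^+ k * K0]mulrC.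
  apply: le_trans q1; rewrite /eta expr2 -mulrA ler_pM2l//.
exists (gam k); split => //; first by rewrite kl.
have gu t := uu_neq0 n2 _ (Gunit _ (gamG t)).
have [xi0 _ _ _ _] := xiP.
have := dP_triangle _ (uu z) _ (gu k) (uu_neq0 n2 _ (Gunit _ zG)) (xi0 _ xc).
move=> /le_trans; apply; rewrite mulrDl mul1r; apply: lerD; last exact: le_trans dz qk.
have kWE : (k + (size W - k) <= size W)%N by rewrite subnKC.
have := ray_sum tau1 gW k (size W - k)%N kWE decay.
rewrite subnKC// take_size WE => /le_trans; apply.
rewrite [leRHS]mulrAC; have Lq : 0 < L * qq (gam k) by rewrite mulr_gt0 ?qq_gt0.
rewrite (ler_pM2l Lq).
by rewrite ler_piMl ?invr_ge0 ?subr_ge0 ?(ltW tau1)// gerBl ltW.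
Qed.

End Cover.

(** * Orbit counting from the critical exponent *)

Section Counting.
Context {R : realType} {n : nat} {S : seq 'M[R]_n}.

Definition gap_ball (T : R) : set 'M[R]_n := [set g | in_gen S g /\ gap12 g <= T].

(** Some neighbourhood of infinity has supremum below [s], and exponentiating gives the bound; an
    infinite count would make the quotient [+oo]. *)
Lemma delta12_count (s : R) : (delta12 S < s%:E)%E ->
  exists s' M : R, [/\ 0 <= s', s' < s & forall T, M < T -> finite_set (gap_ball T) /\
    (#|` fset_set (gap_ball T)|)%:R <= expR (s' * T)].
Proof.
move=> /ereal_inf_lt[_ [V [M0 [_ VM]] <-]].
set f := (fun T : R => _); set b := ereal_sup _ => bs.
(* Beyond [gap12] of the identity the count is at least one, so its logarithm and hence [s'] are
   nonnegative. *)
pose M := Num.max M0 (Num.max 0 (gap12 (1%:M : 'M[R]_n))).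
have fle T : M < T -> (f T <= b)%E.
  rewrite gt_max => /andP[MT _]; apply: ereal_sup_ubound; exists T => //.
  exact: VM.
have T0 T : M < T -> 0 < T by rewrite !gt_max => /and3P[].
have in1 T : M < T -> gap_ball T 1%:M.
  by rewrite !gt_max => /and3P[_ _ /ltW]; split => //; exact: in_gen1.
have f0 T : M < T -> (0 <= f T)%E.
  move=> MT; apply: mule_ge0; last by rewrite lee_fin invr_ge0 ltW// T0.
  rewrite lne_ge0 /counting; case: asboolP => [fin|_]; last exact: leey.
  rewrite lee_fin ler1n cardfs_gt0; apply/fset0Pn; exists 1%:M.
  by rewrite in_fset_set//; exact/mem_set/in1.
have M1 : M < M + 1 by rewrite ltrDl.
have b0 : (0 <= b)%E by apply: le_trans (f0 _ M1) (fle _ M1).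
have bfin : b \is a fin_num by rewrite ge0_fin_numE// (lt_trans bs) ?ltry.
exists (fine b), M; split; first exact: fine_ge0.
  by rewrite -lte_fin fineK.
move=> T MT; have := fle T MT; rewrite -(fineK bfin) /f /counting.
have Tgt := T0 _ MT.
case: asboolP => [fin|inf]; last first.
  by rewrite /= gt0_mulye ?lte_fin ?invr_gt0// leye_eq.
have card0 : (0 < #|` fset_set (gap_ball T)|)%N.
  rewrite cardfs_gt0; apply/fset0Pn; exists 1%:M.
  by rewrite in_fset_set//; exact/mem_set/in1.
rewrite lne_EFin ?ltr0n// -EFinM lee_fin ler_pdivrMr// => H; split => //.
by rewrite -[leLHS]lnK ?ler_expR// posrE ltr0n.
Qed.

End Counting.

(** * Vanishing of the Hausdorff measure above the critical exponent *)

Section Dimension.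
Context {R : realType} {n : nat} {S : seq 'M[R]_n}.
Hypothesis n2 : (1 < n)%N.
Hypothesis Sdet : all (fun g => \det g == 1) S.
Hypothesis anosov : proj_anosov S.
Context {xi : (nat -> 'M[R]_n) -> 'cV[R]_n}.
Hypothesis xiP : boundary_map S xi.
Local Notation G := (in_gen S).

(** The zero vector represents no line and is excluded so that the triangle inequality for [dP]
    applies. *)
Definition pball (c : 'cV[R]_n) (r : R) : set 'cV[R]_n :=
  [set v | v != 0 /\ dP c v <= r].

Lemma diamP_pball c r : c != 0 -> (diamP (pball c r) <= (2 * r)%:E)%E.
Proof.
move=> c0; apply: ge_ereal_sup => _ [u [u0 cu] [v [v0 cv] <-]].
rewrite lee_fin; apply: le_trans (dP_triangle _ c _ u0 c0 v0) _.
by rewrite (dPC u c); lra.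
Qed.

Lemma limit_set_cover : exists2 K : R, 0 < K & forall (J : nat) v, limit_set S xi v ->
  exists g, [/\ G g, J%:R <= gap12 g, v != 0 & dP (uu g) v <= K * expR (- gap12 g)].
Proof.
have [K0 [th [K0gt thgt thlt qqle]]] := anosov_qq anosov.
have [L L1 kapS] := @letters_kap _ _ S.
have [h h0 hyp] := hyperbolicity n2 Sdet K0gt thgt thlt qqle L1 kapS.
have [K Kgt HK] := limit_point_cover n2 Sdet K0gt thgt thlt qqle L1 kapS h0 hyp xiP.
exists K => // J _ [x xc <-].
have [N NP] := geom_small thgt thlt K0 (expR (- J%:R)) (expR_gt0 _).
have [g [gG Ng dg]] := HK x N xc; have [xi0 _ _ _ _] := xiP.
exists g; split => //; first 1 last.
- exact: xi0.
- by rewrite -qqE.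
rewrite -lerN2 -ler_expR -qqE; apply: le_trans (qqle _ gG) (le_trans _ (ltW NP)).
by rewrite ler_pM2l// th_mono.
Qed.

(** Sort the covering elements by the integer part [j] of their gap. At most [expR (s' * j.+1%:R)]
    balls of radius [K * expR (- j%:R)] occur at level [j], so the [s]-th powers sum like a
    geometric series of ratio [rho]. *)
Lemma content_le (s delta e : R) : (delta12 S < s%:E)%E -> 0 < delta -> 0 < e ->
  (hausdorff_content s delta (limit_set S xi) <= e%:E)%E.
Proof.
move=> /delta12_count[s' [M [s'0 s's count]]] delta0 e0.
have [K Kgt cover] := limit_set_cover.
have s0 : 0 < s by exact: le_lt_trans s's.
pose rho := expR (- (s - s')).
have rho0 : 0 < rho by exact: expR_gt0.
have rho1 : rho < 1 by rewrite expR_lt1 oppr_lt0 subr_gt0.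
have e1 : expR (-1) < 1 :> R by rewrite expR_lt1 oppr_lt0.
pose C := (2 * K) `^ s * expR s'.
have Cgt : 0 < C by rewrite mulr_gt0 ?expR_gt0// powR_gt0// mulr_gt0.
pose D := C / (1 - rho).
have Dgt : 0 < D by rewrite divr_gt0// subr_gt0.
have [J1 J1P] := geom_small rho0 rho1 D e e0.
have [J2 J2P] := geom_small (expR_gt0 (-1)) e1 (2 * K) delta delta0.
(* [J1] makes the tail of the series small, [J2] the diameters, and the last term makes the counting
   bound valid. *)
pose J := maxn J1 (maxn J2 (Num.truncn `|M|).+1).
have JM j : (J <= j)%N -> M < j.+1%:R.
  rewrite !geq_max => /and3P[_ _ Mj]; apply: le_lt_trans (ler_norm M) _.
  apply: lt_trans (truncnS_gt _) _; by rewrite ltr_nat ltnS.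
pose E j := fset_set (gap_ball (S := S) j.+1%:R).
pose N j := if (J <= j)%N then size (E j) else 0%N.
pose W j k := if (k < N j)%N
  then pball (uu (nth 0 (E j) k)) (K * expR (-1) ^+ j) else set0.
have NJ j k : (k < N j)%N -> (J <= j)%N by rewrite /N; case: ifP.
have expj j : expR (-1) ^+ j = expR (- j%:R) :> R.
  by rewrite -expRM_natl mulrN1.
have diam j k : (diamP (W j k) <= (2 * K * expR (-1) ^+ j)%:E)%E.
  rewrite /W; case: ifPn => [kN|_]; last by rewrite diamP0 leNye.
  have Jj := NJ _ _ kN; rewrite /N Jj in kN.
  rewrite -mulrA; apply: diamP_pball; apply: (uu_neq0 n2).
  have := mem_nth 0 kN; rewrite in_fset_set; last by have [] := count _ (JM _ Jj).
  by move=> /set_mem[gG _]; exact: in_gen_unit gG.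
pose b j := (2 * K * expR (-1) ^+ j) `^ s.
apply: (le_trans (y := (D * rho ^+ J)%:E)); last first.
  rewrite lee_fin; apply: le_trans (ltW J1P).
  by rewrite (ler_pM2l Dgt) (th_mono rho0 rho1)// leq_maxl.
apply: (hausdorff_content_pairs _ _ _ W N b).
- move=> v /(cover J)[g [gG Jg v0 gv]].
  have g0 : 0 <= gap12 g by apply: le_trans Jg.
  pose j := Num.truncn (gap12 g).
  have /andP[jg gj] := truncn_itv g0.
  have Jj : (J <= j)%N by rewrite -ltnS -(ltr_nat R); exact: le_lt_trans Jg gj.
  have gE : g \in E j.
    rewrite in_fset_set; last by have [] := count _ (JM _ Jj).
    by apply/mem_set; split => //; exact: ltW.
  have kE : (index g (E j) < size (E j))%N by rewrite index_mem.
  exists j, (index g (E j)); rewrite /W /N Jj kE nth_index//; split => //.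
  apply: le_trans gv _; rewrite ler_pM2l// expj ler_expR lerN2//.
- move=> j k; have [kN|kN] := ltnP k (N j); last by rewrite /W ltnNge kN /= diamP0 leNye.
  apply: le_trans (diam j k) _; rewrite lee_fin; apply: le_trans (ltW J2P).
  have KK : 0 < 2 * K by rewrite mulr_gt0.
  rewrite (ler_pM2l KK) (th_mono (expR_gt0 (-1)) e1)//.
  by apply: leq_trans (NJ _ _ kN); rewrite /J !leq_max leqnn orbT.
- by move=> j k Nk; rewrite /W ltnNge Nk.
- move=> j k; apply: hterm_le (ltW s0) _ (diam j k).
  by rewrite !mulr_ge0 ?exprn_ge0 ?expR_ge0 ?(ltW Kgt).
have term j : (N j)%:R * b j <= if (J <= j)%N then C * rho ^+ j else 0.
  rewrite /N; case: ifPn => Jj; last by rewrite mul0r.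
  have [_] := count _ (JM _ Jj); rewrite -/(E j) => Ec.
  apply: (le_trans (y := expR (s' * j.+1%:R) * b j)); first by rewrite ler_wpM2r ?powR_ge0.
  rewrite /b powRM ?exprn_ge0 ?expR_ge0 ?mulr_ge0 ?(ltW Kgt)//.
  rewrite expj /rho -expRM_natl /C /powR [in expR (- j%:R) == 0]gt_eqF ?expR_gt0// expRK.
  rewrite le_eqVlt; apply/orP; left; apply/eqP.
  rewrite mulrCA -!mulrA -!expRD; congr (_ * expR _).
  by rewrite -natr1; ring.
(* Closed form of the partial sums of the tail from [J]; [maxn] makes it vanish while [m <= J]. *)
move=> m; apply: (le_trans (y := D * (rho ^+ J - rho ^+ maxn m J))); last first.
  by rewrite ler_pM2l// gerBl exprn_ge0// ltW.
elim: m => [|m IH]; first by rewrite big_geq// max0n subrr mulr0.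
rewrite big_nat_recr//=; apply: le_trans (lerD IH (term m)) _.
case: leqP => Jm; last by rewrite (maxn_idPr Jm) addr0.
rewrite (maxn_idPl (leqW Jm)) /D exprS le_eqVlt; apply/orP; left; apply/eqP.
by field; rewrite subr_eq0 eq_sym lt_eqF.
Qed.

Lemma hausdorff_measure0 (s : R) : (delta12 S < s%:E)%E ->
  hausdorff_measure s (limit_set S xi) = 0%E.
Proof.
move=> ds; apply/eqP; rewrite eq_le; apply/andP; split.
  apply: ge_ereal_sup => _ [delta delta0 <-]; apply/lee_addgt0Pr => e e0.
  by rewrite add0e; exact: content_le.
apply: (le_trans (y := hausdorff_content s 1 (limit_set S xi))); last first.
  by apply: ereal_sup_ubound; exists 1 => //=.
apply: le_ereal_inf_tmp => _ [U _ <-]; apply: nneseries_ge0 => i _ _.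
exact: hterm_ge0.
Qed.

End Dimension.

Theorem theorem4p1 (R : realType) (n : nat) (S : seq 'M[R]_n)
    (xi : (nat -> 'M[R]_n) -> 'cV[R]_n) :
  (2 <= n)%N ->
  all (fun g => \det g == 1) S ->
  proj_anosov S ->
  boundary_map S xi ->
  (hausdorff_dim (limit_set S xi) <= delta12 S)%E.
Proof.
move=> n2 Sdet anosov xiP.
have dim_le s : (delta12 S < s%:E)%E -> (hausdorff_dim (limit_set S xi) <= s%:E)%E.
  move=> ds; apply: ereal_inf_lbound; exists s => //; split.
    by have [s' [M [s'0 /ltW s's _]]] := delta12_count _ ds; exact: le_trans s's.
  exact: hausdorff_measure0.
case dE : (delta12 S) => [r| |]; last 2 first.
- exact: leey.
(* The value [-oo] is impossible: it would give [0 <= s' < -1]. *)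
- have [|s' [M [s'0 s's _]]] := @delta12_count _ _ S (-1); first by rewrite dE ltNyr.
  by move: (le_lt_trans s'0 s's); rewrite ltr0N1.
apply/lee_addgt0Pr => e e0; rewrite -EFinD; apply: dim_le.
by rewrite dE lte_fin ltrDl.
Qed.
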